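(* Let $\zeta_3=e^{2\pi i/3}$ and $Y(t)=t\,\frac{1-t+t^2}{1+2t+4t^2}$. Then for all $u\in\mathbb{C}$ with $0<|u|$ sufficiently small, \[g(u^3)=\sum_{j=0}^{2} g\!\left(Y(\zeta_3^j u)\right).\]
   Context: $g(t)=\mathrm{m}\!\left((x+y)(x+1)(y+1)-\frac1t xy\right)$, where $\mathrm{m}(P)=\int_0^1\int_0^1\log|P(e^{2\pi i\theta_1},e^{2\pi i\theta_2})|d\theta_1d\theta_2$ is the logarithmic Mahler measure. *)

(* Defs.v *)
From HB Require Import structures.
From mathcomp Require Import all_boot all_order all_algebra.
From mathcomp Require Import all_classical all_reals all_analysis.
From mathcomp Require Import complex.
Set Implicit Arguments. Unset Strict Implicit. Unset Printing Implicit Defensive.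
Import Order.TTheory GRing.Theory Num.Theory.
Local Open Scope ring_scope.
Local Open Scope classical_set_scope.
Local Open Scope complex_scope.

Definition expi2pi {R : realType} (th : R) : R[i] :=
  (cos (2 * pi * th)) +i* (sin (2 * pi * th)).

Definition mahler {R : realType} (P : R[i] -> R[i] -> R[i]) : \bar R :=
  (\int[(@lebesgue_measure R \x @lebesgue_measure R)%E]_(z in `[0%R, 1%R] `*` `[0%R, 1%R])
     (ln (ComplexField.Normc.normc (P (expi2pi z.1) (expi2pi z.2))))%:E)%E.

Definition g {R : realType} (t : R[i]) : \bar R :=
  mahler (fun x y => (x + y) * (x + 1) * (y + 1) - t^-1 * x * y).

Definition zeta3 {R : realType} : R[i] := (-(1/2)) +i* (Num.sqrt 3 / 2).

Definition Yfun {R : realType} (t : R[i]) : R[i] :=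
  t * (1 - t + t ^+ 2) / (1 + 2 * t + 4 * t ^+ 2).

(* Main.v *)
Require Import Defs.
From HB Require Import structures.
From mathcomp Require Import all_boot all_order all_algebra.
From mathcomp Require Import all_classical all_reals all_analysis.
From mathcomp Require Import complex.
From mathcomp Require Import measurable_realfun.
From mathcomp Require Import ring lra zify.
Import Order.TTheory GRing.Theory Num.Theory.
Local Open Scope ring_scope.
Set Implicit Arguments. Unset Strict Implicit. Unset Printing Implicit Defensive.

(** On the torus, [(x + y)(x + 1)(y + 1)/(xy)] is a real function [K], and if
    [t = r/p] then [g t = - ln |r| + avg (ln |p - K r|)].  Writing [Y = N/Q] with
    [N = t - t^2 + t^3] and [Q = 1 + 2t + 4t^2], the claim becomes
      [avg ln|1 - u^3 K| + 2 ln|1 + u^3| = sum_j avg ln|Q - K N| (zeta3^j u)],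
    since [prod_j N (zeta3^j u) = u^3 (1 + u^3)^2].
    Expanding the logarithms in powers of [u], with an explicit remainder so that
    only finite sums are ever integrated, this reduces to
      [A (q_{3m}) = a_m + 2 (-1)^m]  for [m > 0],
    where [A (p) = avg p(K)], [a_m = A (K^m)] and [q_n] is the [n]-th power sum of
    the reciprocal roots of [D = Q - K N] in [t].  The numbers [a_m] satisfy the
    Franel recurrence, by integration by parts on the torus.  The recurrence says
    that [A] kills the image of a differential operator in [K]; an operator
    identity for [1/D] then shows that [A (1/D)] satisfies the differential
    equation of [f(u^3)], [f = sum_m a_m t^m].  Hence [A (1/D) = f(u^3)], and
    the logarithmic derivative of [D] is a rational combination of [1] and [1/D]. *)

(** * Formal power series *)

(* The alias keeps the Cauchy product apart from the pointwise product that
   MathComp-Analysis puts on function types. *)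
Definition fps (S : comNzRingType) := nat -> S.

HB.instance Definition _ (S : comNzRingType) := GRing.Zmodule.copy (fps S) (nat -> S).

Definition is_derivation (S : comNzRingType) (d : S -> S) :=
  (forall a b, d (a + b) = d a + d b) /\ (forall a b, d (a * b) = d a * b + a * d b).

Section FpsRing.
Context {S : comNzRingType}.
Implicit Types (a b c : fps S) (n : nat).

Lemma fpsP a b : (forall n, a n = b n) -> a = b.
Proof. by move=> h; apply/funext. Qed.

Definition fps_one : fps S := fun n => (n == 0%N)%:R.
Definition fps_mul a b : fps S := fun n => \sum_(i < n.+1) a i * b (n - i)%N.

(** Coefficients of a product up to degree [n] depend only on the truncations at [n], so the ring
    laws are inherited from [{poly S}]. *)
Let trunc n a : {poly S} := \poly_(i < n.+1) a i.

Let coef_trunc n a k : (k <= n)%N -> (trunc n a)`_k = a k.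
Proof. by move=> kn; rewrite coef_poly ltnS kn. Qed.

Let trunc_mul n k a b : (k <= n)%N ->
  fps_mul a b k = (trunc n a * trunc n b)`_k.
Proof.
move=> kn; rewrite coefM; apply: eq_bigr => i _.
have ik : (i <= k)%N by rewrite -ltnS.
by rewrite !coef_trunc ?(leq_trans ik)// (leq_trans (leq_subr _ _)).
Qed.

Let eq_coefM (p p' q : {poly S}) n : (forall k, (k <= n)%N -> p`_k = p'`_k) ->
  (p * q)`_n = (p' * q)`_n.
Proof.
move=> h; rewrite !coefM; apply: eq_bigr => i _.
by rewrite h// -ltnS.
Qed.

Let fps_mulC : commutative fps_mul.
Proof. by move=> a b; apply: fpsP => n; rewrite !(@trunc_mul n)// mulrC. Qed.

Let fps_mulA : associative fps_mul.
Proof.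
move=> a b c; apply: fpsP => n; rewrite !(@trunc_mul n)//.
rewrite [RHS](@eq_coefM _ (trunc n a * trunc n b)); last first.
  by move=> k kn; rewrite coef_trunc// (trunc_mul _ _ kn).
rewrite mulrC [LHS](@eq_coefM _ (trunc n b * trunc n c)); last first.
  by move=> k kn; rewrite coef_trunc// (trunc_mul _ _ kn).
by rewrite mulrC mulrA.
Qed.

Let fps_mul1 : left_id fps_one fps_mul.
Proof.
move=> a; apply: fpsP => n; rewrite /fps_mul big_ord_recl/= subn0 mul1r.
by rewrite big1 ?addr0// => i _; rewrite /fps_one/= mul0r.
Qed.

Let fps_mulDl : left_distributive fps_mul +%R.
Proof.
move=> a b c; apply: fpsP => n; rewrite /fps_mul -[RHS]big_split/=.
by apply: eq_bigr => i _; rewrite mulrDl.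
Qed.

Let fps_oner_neq0 : fps_one != 0.
Proof.
by apply/eqP => /(congr1 (fun f : fps S => f 0%N))/eqP; rewrite oner_eq0.
Qed.

HB.instance Definition _ := GRing.Zmodule_isComNzRing.Build (fps S)
  fps_mulA fps_mulC fps_mul1 fps_mulDl fps_oner_neq0.

Definition fpsX : fps S := fun n => (n == 1%N)%:R.
Definition fpsC (x : S) : fps S := fun n => if n is 0 then x else 0.
(** The Euler operator [X d/dX]. *)
Definition theta a : fps S := fun n => n%:R * a n.

Lemma fpsE a b n : (a * b) n = \sum_(i < n.+1) a i * b (n - i)%N.
Proof. by []. Qed.
Lemma fps1E n : (1 : fps S) n = (n == 0%N)%:R. Proof. by []. Qed.
Lemma fpsDE a b n : (a + b) n = a n + b n. Proof. by []. Qed.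
Lemma fpsNE a n : (- a) n = - a n. Proof. by []. Qed.

Lemma fpsMnE a m n : (a *+ m) n = a n *+ m.
Proof. by elim: m => // m ih; rewrite !mulrS fpsDE ih. Qed.

Lemma fpsCM x a n : (fpsC x * a) n = x * a n.
Proof.
rewrite fpsE big_ord_recl subn0 big1 ?addr0// => i _.
by rewrite /fpsC/= mul0r.
Qed.

Lemma fpsXM a n : (fpsX * a) n = if n is n'.+1 then a n' else 0.
Proof.
rewrite fpsE; case: n => [|n]; first by rewrite big_ord1 mul0r.
rewrite 2!big_ord_recl /fpsX/= mul0r add0r mul1r subn1 big1 ?addr0// => i _.
by rewrite mul0r.
Qed.

Lemma fpsXnM m a n : (fpsX ^+ m * a) n = if (m <= n)%N then a (n - m)%N else 0.
Proof.
elim: m a n => [|m ih] a n; first by rewrite expr0 mul1r subn0.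
rewrite exprS -mulrA fpsXM; case: n => [//|n].
by rewrite ih ltnS subSS.
Qed.

Lemma theta_is_derivation : is_derivation (theta : fps S -> fps S).
Proof.
split=> a b; apply: fpsP => n; first by rewrite /theta !fpsDE mulrDr.
rewrite /theta fpsDE !fpsE mulr_sumr -big_split/=; apply: eq_bigr => i _.
have {1}-> : n = (i + (n - i))%N by rewrite subnKC// -ltnS.
by rewrite natrD; ring.
Qed.

Lemma thetaX : theta fpsX = fpsX.
Proof.
by apply: fpsP => -[|[|n]]; rewrite /theta /fpsX/= ?mulr0// mulr1.
Qed.

Lemma thetaC x : theta (fpsC x) = 0.
Proof. by apply: fpsP => -[|n]; rewrite /theta /fpsC/= ?mul0r// mulr0. Qed.

End FpsRing.

Section FpsMap.
Context {S T : comNzRingType}.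

Definition fps_map (f : S -> T) (a : fps S) : fps T := f \o a.

Lemma fps_mapM (f : {rmorphism S -> T}) a b :
  fps_map f (a * b) = fps_map f a * fps_map f b.
Proof.
apply: fpsP => n; rewrite /fps_map/= !fpsE rmorph_sum.
by apply: eq_bigr => i _; rewrite rmorphM.
Qed.

End FpsMap.


(** * Derivations of a commutative ring *)

Section Derivation.
Context (S : comNzRingType) (d : S -> S) (dd : is_derivation d).

Lemma derivation0 : d 0 = 0.
Proof. by have := dd.1 0 0; rewrite addr0 -[X in X = _]addr0 => /addrI. Qed.

Lemma derivation1 : d 1 = 0.
Proof.
by have := dd.2 1 1; rewrite !mulr1 mul1r -[X in X = _]addr0 => /addrI.
Qed.

Lemma derivationN a : d (- a) = - d a.
Proof. by apply/eqP; rewrite -addr_eq0 addrC -dd.1 subrr derivation0. Qed.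

Lemma derivationMn a n : d (a *+ n) = d a *+ n.
Proof.
by elim: n => [|n ih]; rewrite ?mulr0n ?derivation0// !mulrS dd.1 ih.
Qed.

Lemma derivation_nat n : d n%:R = 0.
Proof. by rewrite derivationMn derivation1 mul0rn. Qed.

Lemma derivationX a n : d (a ^+ n.+1) = a ^+ n * d a *+ n.+1.
Proof.
elim: n => [|n ih]; first by rewrite !expr1 expr0 mul1r.
by rewrite [in LHS]exprS dd.2 ih [RHS]mulrS mulrnAr mulrA -exprS [d a * _]mulrC.
Qed.

Lemma derivation_inv a b : a * b = 1 -> d b = - (b ^+ 2 * d a).
Proof.
move=> ab; have := dd.2 a b; rewrite ab derivation1 => h.
have -> : d b = b * (d a * b + a * d b) - b ^+ 2 * d a + (1 - a * b) * d b by ring.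
by rewrite -h ab; ring.
Qed.

Definition derivationE := (dd.1, dd.2, derivationN, derivationX, derivation1, derivation_nat).
End Derivation.

(** * The operator identity for the inverse of the cubic *)

(** Here [R] is [N], and [d1], [d2] are the first and second images of [D] under [u d/du]. The three
    summands are [D^3] times the parts of [cubeOp u b - r * momentOp k b] in [b], [b^2], [b^3] for
    [b = 1/D]. Clearing denominators in this way makes the certificate a polynomial identity. *)
Lemma certificate_poly (S : comNzRingType) (u k : S) :
  let D := 1 + 2 * u + 4 * u ^+ 2 - k * (u - u ^+ 2 + u ^+ 3) in
  let R := u - u ^+ 2 + u ^+ 3 in
  let d1 := 2 * u + 8 * u ^+ 2 - k * (u - 2 * u ^+ 2 + 3 * u ^+ 3) in
  let d2 := 2 * u + 16 * u ^+ 2 - k * (u - 4 * u ^+ 2 + 9 * u ^+ 3) in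
  let w := 1 - 7 * u ^+ 3 - 8 * u ^+ 6 in
  let r := u * ((1 - 2 * u) * (1 + u)) ^+ 2 in
  D ^+ 2 * (- (18 * u ^+ 3 + 72 * u ^+ 6) - r * (k - 2)) +
  D * (- w * d2 + (21 * u ^+ 3 + 48 * u ^+ 6) * d1
       - r * ((3 * k ^+ 2 - 14 * k - 8) * R)) +
  (w * (2 * d1 ^+ 2)
    - r * ((2 * k ^+ 3 - 14 * k ^+ 2 - 16 * k) * R ^+ 2)) = 0.
Proof. by cbv zeta; ring. Qed.

Lemma certificate_combine (S : comNzRingType) (u k b D R d1 d2 w r : S) :
  D * b = 1 ->
  D ^+ 2 * (- (18 * u ^+ 3 + 72 * u ^+ 6) - r * (k - 2)) +
  D * (- w * d2 + (21 * u ^+ 3 + 48 * u ^+ 6) * d1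
       - r * ((3 * k ^+ 2 - 14 * k - 8) * R)) +
  (w * (2 * d1 ^+ 2)
    - r * ((2 * k ^+ 3 - 14 * k ^+ 2 - 16 * k) * R ^+ 2)) = 0 ->
  b * (- (18 * u ^+ 3 + 72 * u ^+ 6) - r * (k - 2)) +
  b ^+ 2 * (- w * d2 + (21 * u ^+ 3 + 48 * u ^+ 6) * d1
       - r * ((3 * k ^+ 2 - 14 * k - 8) * R)) +
  b ^+ 3 * (w * (2 * d1 ^+ 2)
    - r * ((2 * k ^+ 3 - 14 * k ^+ 2 - 16 * k) * R ^+ 2)) = 0.
Proof.
move=> hb.
set x := (X in D ^+ 2 * X); set y := (X in D * X); set z := (X in _ + _ + X = 0).
(* Multiply the hypothesis by [b^3]; the two correction terms are multiples of [D * b - 1]. *)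
move=> h; have -> : b * x + b ^+ 2 * y + b ^+ 3 * z
  = b ^+ 3 * (D ^+ 2 * x + D * y + z)
    - b * (D * b - 1) * (D * b + 1) * x - b ^+ 2 * (D * b - 1) * y.
  by move: x y z {h} => x y z; ring.
by rewrite h hb subrr !(mulr0, mul0r) !subr0.
Qed.

Section Certificate.
Context {S : comNzRingType} (th de : S -> S).
Hypotheses (hth : is_derivation th) (hde : is_derivation de).

(* With [th = u d/du], this is 9 times the operator annihilating [sum a_m t^m],
   taken at [t = u^3]. *)
Definition cubeOp (u b : S) : S :=
  th (th b) - u ^+ 3 * (7 * th (th b) + 21 * th b + 18 * b)
  - 8 * u ^+ 6 * (th (th b) + 6 * th b + 9 * b).

(* With [de = d/dk], it sends [k^n] to
   [(n+1)^2 k^(n+1) - (7n^2+7n+2) k^n - 8n^2 k^(n-1)]. *)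
Definition momentOp (k b : S) : S :=
  k * de (k * de (k * b)) - 7 * (k * de (k * de b)) - 7 * (k * de b) - 2 * b
  - 8 * de (k * de b).

(** Creative telescoping for [1/D]: an operator in [u] alone agrees, up to a factor free of [k],
    with an operator in [k] whose image [A] will kill. *)
Lemma certificate (u k b : S) :
  th u = u -> th k = 0 -> de u = 0 -> de k = 1 ->
  (1 + 2 * u + 4 * u ^+ 2 - k * (u - u ^+ 2 + u ^+ 3)) * b = 1 ->
  cubeOp u b = u * ((1 - 2 * u) * (1 + u)) ^+ 2 * momentOp k b.
Proof.
move=> thu thk deu dek hb.
set D := (X in X * b = 1) in hb.
pose R := u - u ^+ 2 + u ^+ 3.
pose d1 := 2 * u + 8 * u ^+ 2 - k * (u - 2 * u ^+ 2 + 3 * u ^+ 3).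
pose d2 := 2 * u + 16 * u ^+ 2 - k * (u - 4 * u ^+ 2 + 9 * u ^+ 3).
have thD : th D = d1.
  by rewrite /D !(derivationE hth) thu thk /d1; ring.
have thd1 : th d1 = d2.
  by rewrite /d1 !(derivationE hth) thu thk /d2; ring.
have deR : de R = 0 by rewrite /R !(derivationE hde) deu; ring.
have deD : de D = - R.
  by rewrite /D !(derivationE hde) deu dek /R; ring.
have := certificate_poly u k; rewrite -/D -/R -/d1 -/d2.
clearbody D R d1 d2 => hpoly.
have thb : th b = - (b ^+ 2 * d1) by rewrite (derivation_inv hth hb) thD.
have deb : de b = b ^+ 2 * R by rewrite (derivation_inv hde hb) deD; ring.
have thb2 : th (th b) = 2 * b ^+ 3 * d1 ^+ 2 - b ^+ 2 * d2.
  by rewrite thb !(derivationE hth) thb thd1; ring.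
have deb2 : de (k * de b) = b ^+ 2 * R + 2 * k * b ^+ 3 * R ^+ 2.
  by rewrite deb !(derivationE hde) deb dek deR; ring.
have dekb : k * de (k * de (k * b)) =
    k * b + 3 * k ^+ 2 * b ^+ 2 * R + 2 * k ^+ 3 * b ^+ 3 * R ^+ 2.
  have -> : de (k * b) = b + k * b ^+ 2 * R by rewrite hde.2 dek deb; ring.
  by rewrite !(derivationE hde) deb dek deR; ring.
rewrite /cubeOp /momentOp thb2 deb2 dekb thb deb.
apply/eqP; rewrite -subr_eq0 -(certificate_combine hb hpoly).
by apply/eqP; ring.
Qed.
End Certificate.

(** * Invertibility of power series with constant term 1 *)

Section Inverse.
Context {S : comNzRingType}.
Implicit Types (a d e : fps S).

Lemma coef_fps_expr_lt e k n : e 0%N = 0 -> (n < k)%N -> (e ^+ k) n = 0.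
Proof.
move=> e0; elim: k n => // k ih n nk.
rewrite exprS fpsE big_ord_recl e0 mul0r add0r big1// => i _.
by rewrite ih ?mulr0// lift0; case: n i nk => [[]//|n i nk]; rewrite subSS; lia.
Qed.

Lemma eq_fpsM a d e n : (forall k, (k <= n)%N -> d k = e k) ->
  (a * d) n = (a * e) n.
Proof. by move=> h; rewrite !fpsE; apply: eq_bigr => i _; rewrite h// leq_subr. Qed.

Lemma fps_sumE (I : Type) (r : seq I) (P : pred I) (f : I -> fps S) n :
  (\sum_(i <- r | P i) f i) n = \sum_(i <- r | P i) f i n.
Proof. by elim/big_rec2 : _ => // i x y _ <-. Qed.

Lemma fps_inv_exists d : d 0%N = 1 -> exists b, d * b = 1.
Proof.
move=> d0; pose e := 1 - d.
have e0 : e 0%N = 0 by rewrite /e fpsDE fpsNE d0 fps1E subrr.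
(* Geometric series for [1 / (1 - e)]: since [e] has no constant term, [e ^+ k] contributes nothing
   at degrees below [k], so each coefficient is a finite sum. *)
exists (fun n => \sum_(k < n.+1) (e ^+ k) n); apply: fpsP => n.
(* Up to degree [n] the candidate agrees with one fixed partial sum, which telescopes against
   [1 - e]. *)
rewrite (@eq_fpsM _ _ (\sum_(k < n.+1) e ^+ k)); last first.
  move=> k kn; rewrite fps_sumE -!(big_mkord xpredT (fun i => (e ^+ i) k)).
  rewrite [RHS](big_cat_nat _ (n := k.+1))//= [X in _ + X]big_nat_cond.
  rewrite [X in _ + X]big1 ?addr0// => i /andP[/andP[ki _] _].
  exact: coef_fps_expr_lt.
have -> : d = 1 - e by rewrite /e; ring.
have -> : (1 - e) * (\sum_(k < n.+1) e ^+ k) = 1 - e ^+ n.+1.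
  by rewrite -[1 - e]opprB mulNr -subrX1 opprB.
by rewrite fpsDE fpsNE coef_fps_expr_lt ?subr0.
Qed.
End Inverse.

(** * Reciprocal roots and power sums *)

Section Roots.
Context {S : comNzRingType}.

Definition geo (z : S) : fps S := fun n => z ^+ n.

Lemma geoE z : (1 - fpsC z * fpsX) * geo z = 1.
Proof.
apply: fpsP => n; rewrite mulrBl mul1r -mulrA fpsDE fpsNE fpsCM fpsXM.
by case: n => [|n]; rewrite /geo ?mulr0 ?subr0 ?expr0// -exprS subrr.
Qed.

(** The logarithmic derivative splits over the factors: [- theta d / d] is the sum of the
    [w X / (1 - w X) = geo w - 1]. The index starts at 1 because subtracting 1 removes the constant
    terms. *)
Lemma powersum_of_roots (d b : fps S) (x y z : S) :
  d * b = 1 ->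
  d = (1 - fpsC x * fpsX) * (1 - fpsC y * fpsX) * (1 - fpsC z * fpsX) ->
  forall n, (- theta d * b) n.+1 = x ^+ n.+1 + y ^+ n.+1 + z ^+ n.+1.
Proof.
move=> db dE n.
have hth := @theta_is_derivation S.
have th1 (w : S) : theta (1 - fpsC w * fpsX) = - (fpsC w * fpsX).
  by rewrite !(derivationE hth) thetaC thetaX; ring.
have bE : b = geo x * geo y * geo z.
  have : d * (geo x * geo y * geo z) = 1.
    transitivity ((1 - fpsC x * fpsX) * geo x * ((1 - fpsC y * fpsX) * geo y) *
     ((1 - fpsC z * fpsX) * geo z)); first by rewrite dE; ring.
    by rewrite !geoE !mulr1.
  by move=> h; rewrite -[LHS]mulr1 -h mulrCA mulrA db mul1r.
have key : - theta d * b = geo x - 1 + (geo y - 1) + (geo z - 1).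
  have t (w : S) : fpsC w * fpsX * geo w = geo w - 1 by rewrite -(geoE w); ring.
  rewrite -!t bE dE !hth.2 !th1.
  move: (geoE x) (geoE y) (geoE z).
  set p := fpsC x * _; set q := fpsC y * _; set r := fpsC z * _.
  move=> hx hy hz.
  transitivity (p * geo x * ((1 - q) * geo y) * ((1 - r) * geo z)
     + q * geo y * ((1 - p) * geo x) * ((1 - r) * geo z)
     + r * geo z * ((1 - p) * geo x) * ((1 - q) * geo y)); first by ring.
  by rewrite hx hy hz !mulr1.
by rewrite key !fpsDE !fpsNE !fps1E /geo !subr0.
Qed.
End Roots.

(** * The cubic under a functional whose moments satisfy the Franel recurrence *)

Section Cubic.
Context {F : numFieldType} (A : {scalar {poly F}}) (a : nat -> F).

Definition cubicDen (S : comNzRingType) (k : S) : fps S :=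
  1 + 2 * fpsX + 4 * fpsX ^+ 2 - fpsC k * (fpsX - fpsX ^+ 2 + fpsX ^+ 3).

Lemma theta_cubicDen (S : comNzRingType) (k : S) :
  theta (cubicDen k) = 2 * fpsX + 8 * fpsX ^+ 2
    - fpsC k * (fpsX - 2 * fpsX ^+ 2 + 3 * fpsX ^+ 3).
Proof.
have hth := @theta_is_derivation S.
by rewrite /cubicDen !(derivationE hth) thetaC thetaX; ring.
Qed.

Lemma cubicDen0 (S : comNzRingType) (k : S) : cubicDen k 0%N = 1.
Proof.
have -> : cubicDen k = 1 + fpsX * (2 + 4 * fpsX - fpsC k * (1 - fpsX + fpsX ^+ 2)).
  by rewrite /cubicDen; ring.
by rewrite fpsDE fpsXM addr0.
Qed.

Hypothesis A_Xn : forall n, A 'X^n = a n.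
Hypothesis a0 : a 0%N = 1.
Hypothesis franel : forall n,
  n.+1%:R ^+ 2 * a n.+1 = (7 * n%:R ^+ 2 + 7 * n%:R + 2) * a n
                          + 8 * n%:R ^+ 2 * a n.-1.

(** By linearity only monomials matter, and on ['X^n] the claim is the Franel recurrence at [n]. *)
Lemma scalar_momentOp (p : {poly F}) : A (momentOp (@deriv F) 'X p) = 0.
Proof.
have dN m : ('X * deriv 'X^m) = m%:R * 'X^m :> {poly F}.
  by rewrite derivXn mulrnAr mulr_natl; case: m => [|m]; rewrite ?mulr0n// -exprS.
have M n : A (momentOp (@deriv F) 'X 'X^n) = 0.
  have dn m k : deriv (k%:R * 'X^m) = k%:R * deriv 'X^m :> {poly F}.
    by rewrite -polyC_natr mul_polyC derivZ -mul_polyC polyC_natr.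
  have -> : momentOp (@deriv F) 'X 'X^n = (n.+1%:R ^+ 2) *: 'X^(n.+1)
      - (7 * n%:R ^+ 2 + 7 * n%:R + 2) *: 'X^n
      - (8 * n%:R ^+ 2) *: 'X^(n.-1) :> {poly F}.
    have dN2 m k : 'X * deriv (k%:R * 'X^m) = k%:R * (m%:R * 'X^m) :> {poly F}.
      by rewrite dn mulrCA dN.
    rewrite /momentOp -exprS !dN !dN2 dn.
    rewrite [n%:R * deriv 'X^n](_ : _ = n%:R ^+ 2 * 'X^(n.-1)); last first.
      by rewrite derivXn -mulr_natl; ring.
    by rewrite -!mul_polyC !(rmorphD, rmorphM, rmorphXn, rmorph_nat)/=; ring.
  rewrite !linearB/= !linearZ/= !A_Xn franel; ring.
rewrite -[p]coefK poly_def.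
elim/big_ind : _ => [|x y|i _].
- by rewrite /momentOp !(mulr0, deriv0, subr0) linear0.
- have -> : momentOp (@deriv F) 'X (x + y) =
      momentOp (@deriv F) 'X x + momentOp (@deriv F) 'X y.
    by rewrite /momentOp !(mulrDr, derivD); ring.
  by move=> hx hy; rewrite [LHS]linearD/= hx hy addr0.
- have -> (c : F) (q : {poly F}) : momentOp (@deriv F) 'X (c *: q) =
      c *: momentOp (@deriv F) 'X q.
    rewrite /momentOp -!mul_polyC.
    have dc r : deriv (c%:P * r) = c%:P * deriv r by rewrite mul_polyC derivZ mul_polyC.
    by rewrite !(mulrCA 'X c%:P, dc); ring.
  by rewrite linearZ/= M mulr0.
Qed.

Lemma cubeOpE (S : comNzRingType) (b : fps S) n :
  cubeOp theta fpsX b n = n%:R ^+ 2 * b n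
  - (if (3 <= n)%N then (7 * (n - 3)%:R ^+ 2 + 21 * (n - 3)%:R + 18) * b (n - 3)%N else 0)
  - (if (6 <= n)%N then 8 * (n - 3)%:R ^+ 2 * b (n - 6)%N else 0).
Proof.
have nM (c : fps S) m k : (m%:R * c) k = m%:R * c k.
  by rewrite [in LHS]mulr_natl fpsMnE mulr_natl.
rewrite /cubeOp !fpsDE !fpsNE -[8 * _ * _]mulrA nM !fpsXnM !fpsDE !nM /theta.
congr (_ - _ - _); first by ring.
- by case: ifP => _; ring.
- case: ifP => [n6|_]; last by rewrite mulr0.
  (* With [m = n - 6], the factor [m^2 + 6 m + 9] is the square [(n - 3)^2]. *)
  have -> : (n - 3 = (n - 6) + 3)%N by lia.
  by rewrite natrD; ring.
Qed.

(** Applying [A] to the certificate leaves a recurrence with steps 3 and 6, so residues modulo 3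
    decouple. Residues 1 and 2 start at 0 and stay there; at multiples of 3 the recurrence is 9
    times Franel's, with the same initial value. *)
Lemma scalar_cubicDen_inv (b : fps {poly F}) : cubicDen 'X * b = 1 ->
  forall m, [/\ A (b (3 * m)%N) = a m, A (b (3 * m).+1) = 0 & A (b (3 * m).+2) = 0].
Proof.
move=> hb.
have hde : is_derivation (fps_map (@deriv F)).
  split=> x y; apply: fpsP => n; first by rewrite /fps_map/= derivD.
  rewrite /fps_map/= fpsDE !fpsE raddf_sum -big_split/=.
  by apply: eq_bigr => i _; rewrite derivM.
have deX : fps_map (@deriv F) fpsX = 0.
  by apply: fpsP => n; rewrite /fps_map/= /fpsX raddfMn/= derivC mul0rn.
have dek : fps_map (@deriv F) (fpsC 'X) = 1.
  by apply: fpsP => -[|n]; rewrite /fps_map/= ?derivX// derivC.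
have cert := certificate (@theta_is_derivation _) hde thetaX (thetaC _) deX dek hb.
set mo := momentOp _ _ b in cert.
have moE n : mo n = momentOp (@deriv F) 'X (b n).
  have nM (c : fps {poly F}) m k : (m%:R * c) k = m%:R * c k.
    by rewrite [in LHS]mulr_natl fpsMnE mulr_natl.
  have dM (c : fps {poly F}) k : fps_map (@deriv F) c k = deriv (c k) by [].
  by rewrite /mo /momentOp !(fpsDE, fpsNE, nM, fpsCM, dM).
have Amo n : A (mo n) = 0 by rewrite moE scalar_momentOp.
have rec n : A (cubeOp theta fpsX b n) = 0.
  (* The factor [X ((1 - 2 X) (1 + X))^2] is expanded into monomials, so each coefficient is an
     integer combination of values of [mo], all killed by [A]. *)
  have -> : cubeOp theta fpsX b = fpsX ^+ 1 * mo - fpsX ^+ 2 * mo *+ 2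
     - fpsX ^+ 3 * mo *+ 3 + fpsX ^+ 4 * mo *+ 4 + fpsX ^+ 5 * mo *+ 4.
    by rewrite cert; ring.
  rewrite !(fpsDE, fpsNE, fpsMnE) !fpsXnM !(linearD, linearN, linearMn)/=.
  by do 5 (case: ifP => _; rewrite ?Amo ?linear0 ?mul0rn); ring.
have {}rec n : n%:R ^+ 2 * A (b n) =
  (if (3 <= n)%N then (7 * (n - 3)%:R ^+ 2 + 21 * (n - 3)%:R + 18) * A (b (n - 3)%N) else 0)
  + (if (6 <= n)%N then 8 * (n - 3)%:R ^+ 2 * A (b (n - 6)%N) else 0).
  have An m (q : {poly F}) : A (m%:R * q) = m%:R * A q.
    by rewrite -polyC_natr mul_polyC linearZ.
  apply/eqP; rewrite -subr_eq0 opprD addrA; apply/eqP; rewrite -[RHS](rec n) cubeOpE !linearB/=.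
  have c1 (T : comNzRingType) m : 7 * m%:R ^+ 2 + 21 * m%:R + 18 =
      (7 * m ^ 2 + 21 * m + 18)%:R :> T by rewrite -natrX -!natrM -!natrD.
  have c2 (T : comNzRingType) m : 8 * m%:R ^+ 2 = (8 * m ^ 2)%:R :> T.
    by rewrite -natrX -natrM.
  rewrite !c1 !c2 -!natrX An; congr (_ - _ - _).
    by case: ifP => _; rewrite ?An ?linear0.
  by case: ifP => _; rewrite ?An ?linear0.
have b0 : b 0%N = 1.
  have := congr1 (fun f : fps _ => f 0%N) hb.
  by rewrite fpsE big_ord1 cubicDen0 mul1r.
have nz n : n.+1%:R ^+ 2 != 0 :> F by rewrite expf_eq0 pnatr_eq0.
elim/ltn_ind => m ih.
(* Shifting the index back by 3 or 6 keeps the residue [r] and reaches a smaller [m], where the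
   induction hypothesis gives 0. *)
have z r : (r < 3)%N -> (r != 0)%N -> A (b (3 * m + r)%N) = 0.
  move=> r3 r0; have := rec (3 * m + r)%N.
  rewrite [X in X + _](_ : _ = 0); last first.
    case: ifP => // h; have m1 : (m.-1 < m)%N by lia.
    have [_ h1 h2] := ih _ m1.
    have [->|->] : (3 * m + r - 3 = (3 * m.-1).+1 \/ 3 * m + r - 3 = (3 * m.-1).+2)%N by lia.
      by rewrite h1 mulr0.
    by rewrite h2 mulr0.
  rewrite [X in _ + X](_ : _ = 0); last first.
    case: ifP => // h; have m1 : (m.-2 < m)%N by lia.
    have [_ h1 h2] := ih _ m1.
    have [->|->] : (3 * m + r - 6 = (3 * m.-2).+1 \/ 3 * m + r - 6 = (3 * m.-2).+2)%N by lia.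
      by rewrite h1 mulr0.
    by rewrite h2 mulr0.
  have -> : (3 * m + r = (3 * m + r).-1.+1)%N by lia.
  by move/eqP; rewrite addr0 mulf_eq0 (negbTE (nz _)) => /eqP.
split; [|by have := z 1%N; rewrite addn1; apply|by have := z 2%N; rewrite addn2; apply].
case: m ih {z} => [_|m ih]; first by rewrite muln0 b0 -[1](expr0 'X) A_Xn.
have e : (3 * m.+1 = (3 * m.+1).-1.+1)%N by lia.
apply: (mulfI (nz (3 * m.+1).-1)); rewrite -e rec; have -> : (2 < 3 * m.+1)%N by lia.
have -> : (3 * m.+1 - 3 = 3 * m)%N by lia.
have [-> _ _] := ih _ (ltnSn m).
have := franel m; rewrite !natrM => fr.
have -> : (3%:R * m.+1%:R) ^+ 2 * a m.+1 = 9 * (m.+1%:R ^+ 2 * a m.+1) by ring.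
rewrite fr; case: m ih {fr e} => [|m] ih; first by rewrite (_ : (5 < 3 * 1)%N = false)//; ring.
have -> : (5 < 3 * m.+2)%N by lia.
have -> : (3 * m.+2 - 6 = 3 * m)%N by lia.
have [-> _ _] := ih m ltac:(lia).
by rewrite /=; ring.
Qed.

(** [D] is affine in [k], so eliminating [k] writes [- theta D / D] through 1 and [1/D] with
    denominator [1 - X + X^2]. Multiplying by [1 + X] turns this into [1 + X^3], which respects
    residues modulo 3. The resulting recurrence for sums of neighbours has the solution
    [a m + 2 (-1)^m]. *)
Lemma scalar_cubicDen_powersum (b : fps {poly F}) : cubicDen 'X * b = 1 ->
  forall m, A ((- theta (cubicDen 'X) * b) (3 * m.+1)%N) = a m.+1 + 2 * (-1) ^+ m.+1.
Proof.
move=> hb; set q := - _ * _.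
have key : q + fpsX ^+ 3 * q = b - fpsX ^+ 1 * b - fpsX ^+ 2 * b *+ 5 + fpsX ^+ 3 * b
  + fpsX ^+ 4 * b *+ 8 + fpsX ^+ 5 * b *+ 4
  - (1 - fpsX ^+ 1 * 1 + fpsX ^+ 2 * 1 + fpsX ^+ 3 * 1 *+ 3).
  have hD : (1 + fpsX ^+ 3) * - theta (cubicDen 'X) =
      (1 - fpsX - fpsX ^+ 2 *+ 5 + fpsX ^+ 3 + fpsX ^+ 4 *+ 8 + fpsX ^+ 5 *+ 4)
      - (1 - fpsX + fpsX ^+ 2 + fpsX ^+ 3 *+ 3) * cubicDen ('X : {poly F}).
    by rewrite theta_cubicDen /cubicDen; ring.
  transitivity ((1 + fpsX ^+ 3) * - theta (cubicDen 'X) * b); first by rewrite /q; ring.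
  by rewrite hD mulrBl -(mulrA _ _ b) hb; ring.
have coef := scalar_cubicDen_inv hb.
(* At multiples of 3 only [b] and [fpsX ^+ 3 * b] survive [A]. The 3 is the coefficient of [X^3] in
   the polynomial part, hence occurs only for [m = 0]. *)
have rec m : A (q (3 * m.+1)%N) + A (q (3 * m)%N) =
    a m.+1 + a m - (if m is 0 then 3 else 0).
  have := congr1 (fun f : fps _ => A (f (3 * m.+1)%N)) key.
  rewrite !(fpsDE, fpsNE, fpsMnE) !fpsXnM !fps1E.
  have -> : (3 * m.+1 = (3 * m).+3)%N by lia.
  have [e1 e2 e3] := coef m; have [e4 _ _] := coef m.+1.
  rewrite (_ : (3 * m.+1)%N = (3 * m).+3) in e4; last by lia.
  rewrite !subSS !subn0/= !(linearD, linearN, linearMn)/=.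
  have A1 : A 1 = 1 by rewrite -(expr0 'X) A_Xn.
  rewrite A1 e2 e3 e4 e1.
  have -> : A (if (3 < (3 * m).+3)%N then b (3 * m - 1)%N else 0) = 0.
    case: m {e1 e2 e3 e4} => [|m]; first by rewrite linear0.
    have [_ _ h] := coef m.
    have -> : (3 * m.+1 - 1 = (3 * m).+2)%N by lia.
    by case: (_ < _)%N; rewrite ?h ?linear0.
  have -> : A (if (4 < (3 * m).+3)%N then b (3 * m - 2)%N else 0) = 0.
    case: m {e1 e2 e3 e4} => [|m]; first by rewrite linear0.
    have [_ h _] := coef m.
    have -> : (3 * m.+1 - 2 = (3 * m).+1)%N by lia.
    by case: (_ < _)%N; rewrite ?h ?linear0.
  move=> ->; case: m {e1 e2 e3 e4} => [|m]; first by rewrite muln0 eqxx /=; ring.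
  by rewrite muln_eq0/=; ring.
elim=> [|m ih].
  have := rec 0%N; rewrite muln0 [q 0%N](_ : _ = 0); last first.
    by rewrite /q fpsE big_ord1 fpsNE /theta mul0r oppr0 mul0r.
  rewrite linear0 addr0 => ->; have := franel 0; rewrite a0 => h.
  have -> : a 1%N = 2 by move: h; rewrite expr1n mul1r => ->; ring.
  by ring.
have := rec m.+1; rewrite ih /= subr0 => /(canRL (addrK _)) ->.
rewrite !exprS; ring.
Qed.
End Cubic.

(** * Averages over the torus *)

Import numFieldNormedType.Exports.
Local Open Scope classical_set_scope.

Section TorusAverage.
Context {R : realType}.
Local Notation leb := (@lebesgue_measure R).
Local Notation I01 := (`[0%R, 1%R] : set R).

Definition square : set (R * R) := I01 `*` I01.
Local Notation mu2 := (leb \x leb)%E.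

Lemma measurable_square : measurable square.
Proof. by apply: measurableX; exact: measurable_itv. Qed.

Lemma measure_square : mu2 square = 1%E.
Proof.
transitivity (leb I01 * leb I01)%E.
  by apply: product_measure1E; exact: measurable_itv.
by rewrite lebesgue_measure_itv/= lte_fin ltr01 sube0 mule1.
Qed.

Definition average (f : R * R -> R) : R := \int[mu2]_(z in square) f z.

(** A class closed under sums and products, on which averages are finite and Fubini applies. *)
Definition tame (f : R * R -> R) :=
  measurable_fun square f /\ exists M, forall z, square z -> `|f z| <= M.

Lemma tame_integrable f : tame f -> mu2.-integrable square (EFin \o f).
Proof.
move=> [mf [M fM]]; apply: measurable_bounded_integrable => //.
- exact: measurable_square.
- by apply: (@le_lt_trans _ _ 1%E); rewrite ?ltry// -measure_square.
- by exists M; split; [exact: num_real | move=> x Mx z /fM /le_trans; apply; exact: ltW].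
Qed.

Lemma tameD f g : tame f -> tame g -> tame (fun z => f z + g z).
Proof.
move=> [mf [M fM]] [mg [N gN]]; split; first exact: measurable_funD.
exists (M + N) => z Dz; apply: (le_trans (ler_normD _ _)).
by rewrite lerD ?fM ?gN.
Qed.

Lemma tameM f g : tame f -> tame g -> tame (fun z => f z * g z).
Proof.
move=> [mf [M fM]] [mg [N gN]]; split; first exact: measurable_funM.
exists (M * N) => z Dz; rewrite normrM.
by rewrite ler_pM ?fM ?gN.
Qed.

Lemma tame_cst c : tame (fun=> c).
Proof. by split; [exact: measurable_cst | exists `|c|]. Qed.

Lemma averageD f g : tame f -> tame g ->
  average (fun z => f z + g z) = average f + average g.
Proof.
by move=> /tame_integrable hf /tame_integrable hg; rewrite /average RintegralD//; exact: measurable_square.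
Qed.

Lemma averageZ c f : tame f -> average (fun z => c * f z) = c * average f.
Proof.
by move=> /tame_integrable hf; rewrite /average RintegralZl//; exact: measurable_square.
Qed.

Lemma average_cst c : average (fun=> c) = c.
Proof.
rewrite /average Rintegral_cst; last exact: measurable_square.
by rewrite -[RHS]mulr1; congr (_ * _); exact: (congr1 fine measure_square).
Qed.

Lemma average_norm_le f M : tame f -> (forall z, square z -> `|f z| <= M) ->
  `|average f| <= M.
Proof.
move=> tf fM; have [mf _] := tf.
have h := tame_integrable tf.
apply: le_trans; first by apply: le_normr_Rintegral h; exact: measurable_square.
rewrite -[leRHS]average_cst; apply: le_Rintegral => //.
- exact: measurable_square.
- apply: tame_integrable; split; first exact: measurableT_comp.
  by exists M => z Dz; rewrite normr_id fM.
- exact: tame_integrable (tame_cst M).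
Qed.

Lemma EFin_average f : tame f -> (\int[mu2]_(z in square) (f z)%:E)%E = (average f)%:E.
Proof.
move=> tf; rewrite /average /Rintegral fineK//.
by apply: integrable_fin_num; [exact: measurable_square|exact: tame_integrable].
Qed.

Lemma average_fubini f : tame f ->
  (\int[leb]_(x in I01) \int[leb]_(y in I01) (f (x, y))%:E)%E = (average f)%:E /\
  (\int[leb]_(y in I01) \int[leb]_(x in I01) (f (x, y))%:E)%E = (average f)%:E.
Proof.
move=> tf; rewrite -EFin_average//.
(* Fubini is applied on the whole plane, to [f] extended by zero outside the square. *)
have hi : mu2.-integrable setT ((EFin \o f) \_ square).
  by apply/integrable_restrict => //; [exact: measurable_square|rewrite setTI; exact: tame_integrable].
split.
- rewrite [RHS]integral_mkcond; etransitivity; last first.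
    exact: (integral12_prod_meas1 hi).
  rewrite [LHS]integral_mkcond.
  apply: eq_integral => x _; rewrite /fubini_F [LHS]patchE; case: ifPn => xI.
    rewrite [LHS]integral_mkcond; apply: eq_integral => y _.
    by rewrite !patchE in_setX xI.
  by rewrite integral0_eq// => y _; rewrite patchE in_setX (negbTE xI).
- rewrite [RHS]integral_mkcond; etransitivity; last first.
    exact: (integral21_prod_meas1 hi).
  rewrite [LHS]integral_mkcond.
  apply: eq_integral => x _; rewrite /fubini_G [LHS]patchE; case: ifPn => xI.
    rewrite [LHS]integral_mkcond; apply: eq_integral => y _.
    by rewrite !patchE in_setX xI andbT.
  by rewrite integral0_eq// => y _; rewrite patchE in_setX (negbTE xI) andbF.
Qed.

Lemma integral_periodic_derive (F f : R -> R) :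
  (forall x : R, is_derive x (1 : R) F (f x)) -> continuous f -> F 0 = F 1 ->
  (\int[leb]_(x in I01) (f x)%:E = 0)%E.
Proof.
move=> dF cf F01.
have cF : continuous F.
  by move=> x; apply: differentiable_continuous; apply/derivable1_diffP; case: (dF x).
rewrite (@continuous_FTC2 _ f F)//.
- by rewrite F01 subee.
- exact: continuous_subspaceT.
- split; first by move=> x _; case: (dF x).
  + exact: cvg_at_right_filter (cF 0).
  + exact: cvg_at_left_filter (cF 1).
- by move=> x _; rewrite derive1E; apply: derive_val.
Qed.

(** Trigonometric polynomials in two angles are kept as syntax, so that partial derivatives are
    again terms and identities between them reduce to [ring]. *)
Inductive trig :=
  Cst of R | CosA | SinA | CosB | SinB | Add of trig & trig | Mul of trig & trig.

Fixpoint trig_eval (e : trig) (z : R * R) : R := match e with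
  | Cst c => c
  | CosA => cos (2 * pi * z.1) | SinA => sin (2 * pi * z.1)
  | CosB => cos (2 * pi * z.2) | SinB => sin (2 * pi * z.2)
  | Add e1 e2 => trig_eval e1 z + trig_eval e2 z
  | Mul e1 e2 => trig_eval e1 z * trig_eval e2 z
  end.

(* Derivatives are with respect to the angles [2 pi z.1] and [2 pi z.2]. *)
Fixpoint trig_da (e : trig) : trig := match e with
  | CosA => Mul (Cst (-1)) SinA | SinA => CosA
  | Add e1 e2 => Add (trig_da e1) (trig_da e2)
  | Mul e1 e2 => Add (Mul (trig_da e1) e2) (Mul e1 (trig_da e2))
  | _ => Cst 0
  end.

Fixpoint trig_db (e : trig) : trig := match e with
  | CosB => Mul (Cst (-1)) SinB | SinB => CosB
  | Add e1 e2 => Add (trig_db e1) (trig_db e2)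
  | Mul e1 e2 => Add (Mul (trig_db e1) e2) (Mul e1 (trig_db e2))
  | _ => Cst 0
  end.

Lemma is_derive_trig_da e (x y : R) :
  is_derive x (1 : R) (fun a => trig_eval e (a, y)) (2 * pi * trig_eval (trig_da e) (x, y)).
Proof.
elim: e => [c|||||e1 d1 e2 d2|e1 d1 e2 d2] /=.
- by apply: is_derive_eq; rewrite mulr0.
- by apply: is_derive_eq; rewrite !scaler1 /=; ring.
- by apply: is_derive_eq; rewrite !scaler1 /=; ring.
- by apply: is_derive_eq; rewrite mulr0.
- by apply: is_derive_eq; rewrite mulr0.
- by rewrite mulrDr; exact: is_deriveD.
- have h := is_deriveM d1 d2; apply: (is_derive_eq h).
  by rewrite /GRing.scale/=; ring.
Qed.

Lemma is_derive_trig_db e (x y : R) :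
  is_derive y (1 : R) (fun b => trig_eval e (x, b)) (2 * pi * trig_eval (trig_db e) (x, y)).
Proof.
elim: e => [c|||||e1 d1 e2 d2|e1 d1 e2 d2] /=.
- by apply: is_derive_eq; rewrite mulr0.
- by apply: is_derive_eq; rewrite mulr0.
- by apply: is_derive_eq; rewrite mulr0.
- by apply: is_derive_eq; rewrite !scaler1 /=; ring.
- by apply: is_derive_eq; rewrite !scaler1 /=; ring.
- by rewrite mulrDr; exact: is_deriveD.
- have h := is_deriveM d1 d2; apply: (is_derive_eq h).
  by rewrite /GRing.scale/=; ring.
Qed.

Lemma tame_trig e : tame (trig_eval e).
Proof.
have mcos (f : R * R -> R) : measurable_fun setT f -> measurable_fun setT (fun z => cos (2 * pi * f z)).
  move=> mf; apply: (measurableT_comp (f := fun x => cos x)).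
    by apply: continuous_measurable_fun; exact: continuous_cos.
  by apply: measurable_funM => //; exact: measurable_cst.
have msin (f : R * R -> R) : measurable_fun setT f -> measurable_fun setT (fun z => sin (2 * pi * f z)).
  move=> mf; apply: (measurableT_comp (f := fun x => sin x)).
    by apply: continuous_measurable_fun; exact: continuous_sin.
  by apply: measurable_funM => //; exact: measurable_cst.
elim: e => [c|||||e1 d1 e2 d2|e1 d1 e2 d2].
- exact: tame_cst.
- split; last by exists 1 => z _; rewrite ler_norml cos_geN1 cos_le1.
  by apply: measurable_funTS; exact: (mcos _ measurable_fst).
- split; last by exists 1 => z _; rewrite ler_norml sin_geN1 sin_le1.
  by apply: measurable_funTS; exact: (msin _ measurable_fst).
- split; last by exists 1 => z _; rewrite ler_norml cos_geN1 cos_le1.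
  by apply: measurable_funTS; exact: (mcos _ measurable_snd).
- split; last by exists 1 => z _; rewrite ler_norml sin_geN1 sin_le1.
  by apply: measurable_funTS; exact: (msin _ measurable_snd).
- exact: tameD.
- exact: tameM.
Qed.

Lemma trig_periodic e (x y : R) :
  trig_eval e (0, y) = trig_eval e (1, y) /\ trig_eval e (x, 0) = trig_eval e (x, 1).
Proof.
have c : cos (2 * pi * 0 : R) = cos (2 * pi * 1).
  by rewrite mulr0 mulr1 mulr_natl cos2pi cos0.
have s : sin (2 * pi * 0 : R) = sin (2 * pi * 1).
  by rewrite mulr0 mulr1 mulr_natl sin2pi sin0.
by elim: e => //= e1 [-> ->] e2 [-> ->].
Qed.

(** Integration by parts on the torus: Fubini puts the differentiated variable inside, and the
    integral of a derivative over a full period is zero. The factor [2 * pi] converts the angle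
    derivative into the derivative in [z.1]. *)
Lemma average_trig_da e : average (trig_eval (trig_da e)) = 0.
Proof.
have pi20 : 2 * pi != 0 :> R by rewrite mulf_neq0// gt_eqF// pi_gt0.
apply: (mulfI pi20); rewrite mulr0 -averageZ; last exact: tame_trig.
apply: EFin_inj; set f := fun z => _.
have tf : tame f by apply: tameM; [exact: tame_cst|exact: tame_trig].
rewrite -(average_fubini tf).2 integral0_eq// => y _.
apply: (@integral_periodic_derive (fun a => trig_eval e (a, y))).
- by move=> x; exact: is_derive_trig_da.
- move=> x; apply: differentiable_continuous; apply/derivable1_diffP.
  have [h _] := is_derive_trig_da (Mul (Cst (2 * pi)) (trig_da e)) x y.
  exact: h.
- exact: (trig_periodic e 0 y).1.
Qed.

Lemma average_trig_db e : average (trig_eval (trig_db e)) = 0.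
Proof.
have pi20 : 2 * pi != 0 :> R by rewrite mulf_neq0// gt_eqF// pi_gt0.
apply: (mulfI pi20); rewrite mulr0 -averageZ; last exact: tame_trig.
apply: EFin_inj; set f := fun z => _.
have tf : tame f by apply: tameM; [exact: tame_cst|exact: tame_trig].
rewrite -(average_fubini tf).1 integral0_eq// => x _.
apply: (@integral_periodic_derive (fun b => trig_eval e (x, b))).
- by move=> y; exact: is_derive_trig_db.
- move=> y; apply: differentiable_continuous; apply/derivable1_diffP.
  have [h _] := is_derive_trig_db (Mul (Cst (2 * pi)) (trig_db e)) x y.
  exact: h.
- exact: (trig_periodic e x 0).2.
Qed.
End TorusAverage.

(** * The Franel recurrence for the moments of the kernel *)

Section Franel.
Context {R : realType}.
Local Notation trig := (@trig R).

Definition trig_sum (s : seq (R * trig)) : trig :=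
  foldr (fun p e => Add (Mul (Cst p.1) p.2) e) (Cst 0) s.

(** Expanded form of [sin (a - b)]; [CosAmB] is likewise [cos (a - b)]. *)
Definition SinAmB : trig := Add (Mul SinA CosB) (Mul (Cst (-1)) (Mul CosA SinB)).
Definition CosAmB : trig := Add (Mul CosA CosB) (Mul SinA SinB).

Definition kernel_trig : trig :=
  trig_sum [:: (2, Cst 1); (2, CosA); (2, CosB); (2, CosAmB)].
(* [(x + y)(x + 1)(y + 1)/(xy)] on the torus, see [kernel_expi2pi]. *)
Definition kernel : R * R -> R := trig_eval kernel_trig.

Fixpoint trig_pow (e : trig) (n : nat) : trig :=
  if n is n'.+1 then Mul e (trig_pow e n') else Cst 1.

Lemma trig_eval_pow e n z : trig_eval (trig_pow e n) z = trig_eval e z ^+ n.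
Proof. by elim: n => [|n /= ->]; rewrite ?expr0// exprS. Qed.

Lemma trig_da_pow e n z : trig_eval (trig_da (trig_pow e n.+1)) z =
  n.+1%:R * trig_eval (trig_da e) z * trig_eval e z ^+ n.
Proof.
elim: n => [|n ih]; first by rewrite /=; ring.
transitivity (trig_eval (trig_da e) z * trig_eval (trig_pow e n.+1) z +
  trig_eval e z * trig_eval (trig_da (trig_pow e n.+1)) z) => //.
rewrite ih trig_eval_pow.
by rewrite -[n.+2]addn1 natrD exprS; ring.
Qed.

Lemma trig_db_pow e n z : trig_eval (trig_db (trig_pow e n.+1)) z =
  n.+1%:R * trig_eval (trig_db e) z * trig_eval e z ^+ n.
Proof.
elim: n => [|n ih]; first by rewrite /=; ring.
transitivity (trig_eval (trig_db e) z * trig_eval (trig_pow e n.+1) z +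
  trig_eval e z * trig_eval (trig_db (trig_pow e n.+1)) z) => //.
rewrite ih trig_eval_pow.
by rewrite -[n.+2]addn1 natrD exprS; ring.
Qed.

(* The divergence of [kernel^m] times [(fluxA0 + m fluxA1, fluxB0 + m fluxB1)]
   is the Franel recurrence at [n = m + 1]; the coefficients were found by linear
   algebra over trigonometric polynomials of degree 2. *)
Definition fluxA0 : trig := trig_sum [:: (3, SinB); (-8, Mul (Cst 2) (Mul SinB CosB));
  (10, Add (Mul SinAmB CosB) (Mul (Cst (-1)) (Mul CosAmB SinB)));
  (8, SinAmB); (16, SinA); (8, Add (Mul SinA CosB) (Mul CosA SinB));
  (4, Mul SinAmB CosAmB);
  (3, Add (Mul SinAmB CosA) (Mul CosAmB SinA)); (8, Mul SinA CosA)].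
Definition fluxA1 : trig := trig_sum [:: (10, SinB); (-4, Mul (Cst 2) (Mul SinB CosB));
  (5, Add (Mul SinAmB CosB) (Mul (Cst (-1)) (Mul CosAmB SinB)));
  (15, SinA); (10, Add (Mul SinA CosB) (Mul CosA SinB));
  (2, Mul SinAmB CosAmB); (4, Mul SinA CosA)].

(** The kernel is symmetric in the two angles, so the second flux component can be taken as the
    mirror image of the first. *)
Fixpoint trig_swap (e : trig) : trig := match e with
  | Cst c => Cst c | CosA => CosB | SinA => SinB | CosB => CosA | SinB => SinA
  | Add e1 e2 => Add (trig_swap e1) (trig_swap e2)
  | Mul e1 e2 => Mul (trig_swap e1) (trig_swap e2)
  end.

Definition fluxB0 := trig_swap fluxA0.
Definition fluxB1 := trig_swap fluxA1.

Let ev e z := @trig_eval R e z.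

(** The divergence of [kernel^m (F0 + m F1)] is [kernel^(m-1)] times a quadratic in [m]. With [K]
    for the kernel, [flux0], [flux1] and [flux2] match its constant, linear and quadratic parts with
    those of [K ((m+2)^2 K^2 - (7 (m+1)^2 + 7 (m+1) + 2) K - 8 (m+1)^2)]; in [flux0] the common
    factor [K] is cancelled. *)
Lemma flux0 z : ev (trig_da fluxA0) z + ev (trig_db fluxB0) z =
  4 * kernel z ^+ 2 - 16 * kernel z - 8.
Proof.
have ha : sin (2 * pi * z.1) ^+ 2 = 1 - cos (2 * pi * z.1) ^+ 2 by rewrite sin2cos2.
have hb : sin (2 * pi * z.2) ^+ 2 = 1 - cos (2 * pi * z.2) ^+ 2 by rewrite sin2cos2.
rewrite /kernel /ev /=.
move: ha hb; move: (sin _) (cos _) (sin _) (cos _) => sa ca sb cb ha hb.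
ring: ha hb.
Qed.

Lemma flux1 z :
  kernel z * (ev (trig_da fluxA1) z + ev (trig_db fluxB1) z)
  + ev fluxA0 z * ev (trig_da kernel_trig) z + ev fluxB0 z * ev (trig_db kernel_trig) z =
  kernel z * (4 * kernel z ^+ 2 - 21 * kernel z - 16).
Proof.
have ha : sin (2 * pi * z.1) ^+ 2 = 1 - cos (2 * pi * z.1) ^+ 2 by rewrite sin2cos2.
have hb : sin (2 * pi * z.2) ^+ 2 = 1 - cos (2 * pi * z.2) ^+ 2 by rewrite sin2cos2.
rewrite /kernel /ev /=.
move: ha hb; move: (sin _) (cos _) (sin _) (cos _) => sa ca sb cb ha hb.
ring: ha hb.
Qed.

Lemma flux2 z :
  ev fluxA1 z * ev (trig_da kernel_trig) z + ev fluxB1 z * ev (trig_db kernel_trig) z =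
  kernel z * (kernel z ^+ 2 - 7 * kernel z - 8).
Proof.
have ha : sin (2 * pi * z.1) ^+ 2 = 1 - cos (2 * pi * z.1) ^+ 2 by rewrite sin2cos2.
have hb : sin (2 * pi * z.2) ^+ 2 = 1 - cos (2 * pi * z.2) ^+ 2 by rewrite sin2cos2.
rewrite /kernel /ev /=.
move: ha hb; move: (sin _) (cos _) (sin _) (cos _) => sa ca sb cb ha hb.
ring: ha hb.
Qed.


Definition moment (n : nat) : R := average (fun z => kernel z ^+ n).

Lemma tame_kernelX n : tame (fun z => kernel z ^+ n).
Proof.
have -> : (fun z => kernel z ^+ n) = trig_eval (trig_pow kernel_trig n).
  by apply/funext => z; rewrite trig_eval_pow.
exact: tame_trig.
Qed.

Lemma moment0 : moment 0 = 1.
Proof.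
exact: average_cst.
Qed.

Lemma average_lin2 c1 c2 c3 (f1 f2 f3 : R * R -> R) : tame f1 -> tame f2 -> tame f3 ->
  average (fun z => c1 * f1 z + c2 * f2 z + c3 * f3 z) =
  c1 * average f1 + c2 * average f2 + c3 * average f3.
Proof.
move=> t1 t2 t3.
have tZ c f : tame f -> tame (fun z => c * f z) by move=> tf; apply: tameM => //; exact: tame_cst.
rewrite averageD; [|apply: tameD; exact: tZ|exact: tZ].
by rewrite averageD ?averageZ//; exact: tZ.
Qed.

Lemma average_divergence (e1 e2 : trig) (f : R * R -> R) :
  (forall z, f z = ev (trig_da e1) z + ev (trig_db e2) z) -> average f = 0.
Proof.
move=> /funext ->; rewrite averageD; [|exact: tame_trig|exact: tame_trig].
by rewrite average_trig_da average_trig_db addr0.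
Qed.

Lemma moment_franel n : n.+1%:R ^+ 2 * moment n.+1 =
  (7 * n%:R ^+ 2 + 7 * n%:R + 2) * moment n + 8 * n%:R ^+ 2 * moment n.-1.
Proof.
apply/eqP; rewrite -subr_eq0 opprD addrA -!mulNr -average_lin2//; try exact: tame_kernelX.
apply/eqP; case: n => [|m].
  (* For [n = 0] the integrand is [kernel - 2], the divergence of
     [(2 sin a + 2 sin (a - b), 2 sin b)]. *)
  apply: (@average_divergence (trig_sum [:: (2, SinA); (2, SinAmB)])
    (trig_sum [:: (2, SinB)])) => z.
  by rewrite /kernel /ev /=; ring.
apply: (@average_divergence
    (Mul (Add fluxA0 (Mul (Cst m%:R) fluxA1)) (trig_pow kernel_trig m))
    (Mul (Add fluxB0 (Mul (Cst m%:R) fluxB1)) (trig_pow kernel_trig m))) => z.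
have f0 := flux0 z; have f1 := flux1 z; have f2 := flux2 z.
(* The product rule separates the divergence of the flux from the gradient of [kernel^m]. *)
transitivity (kernel z ^+ m * (ev (trig_da fluxA0) z + ev (trig_db fluxB0) z
    + m%:R * (ev (trig_da fluxA1) z + ev (trig_db fluxB1) z)) +
  ((ev fluxA0 z + m%:R * ev fluxA1 z) * ev (trig_da (trig_pow kernel_trig m)) z +
   (ev fluxB0 z + m%:R * ev fluxB1 z) * ev (trig_db (trig_pow kernel_trig m)) z));
  last first.
  rewrite -[kernel z ^+ m]trig_eval_pow /ev; cbn [trig_da trig_db trig_eval]; ring.
(* The power rule is stated for positive exponents; at [m = 0] the gradient term vanishes and
   [flux0] suffices. *)
case: m => [|m].
  by rewrite /= f0; ring.
rewrite /ev trig_da_pow trig_db_pow -/ev -/kernel.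
move: f0 f1 f2; rewrite /ev.
set a0 := trig_eval (trig_da fluxA0) z; set b0 := trig_eval (trig_db fluxB0) z.
set a1 := trig_eval (trig_da fluxA1) z; set b1 := trig_eval (trig_db fluxB1) z.
set u0 := trig_eval fluxA0 z; set v0 := trig_eval fluxB0 z.
set u1 := trig_eval fluxA1 z; set v1 := trig_eval fluxB1 z.
set ka := trig_eval (trig_da kernel_trig) z; set kb := trig_eval (trig_db kernel_trig) z.
rewrite -/(kernel z); move: (kernel z) => K f0 f1 f2.
rewrite f0 !exprS.
transitivity (K ^+ m * (K * (4 * K ^+ 2 - 16 * K - 8) + m.+1%:R * (K * (4 * K ^+ 2 - 21 * K - 16))
  + m.+1%:R ^+ 2 * (K * (K ^+ 2 - 7 * K - 8)))); first by rewrite /=; ring.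
by rewrite -f1 -f2; ring.
Qed.

(** The functional [A] to which the results on the cubic are applied. *)
Definition poly_average (p : {poly R}) : R := average (fun z => p.[kernel z]).

Lemma tame_horner (p : {poly R}) : tame (fun z => p.[kernel z]).
Proof.
elim/poly_ind: p => [|p c ih].
  rewrite (_ : (fun z => _) = fun=> 0); first exact: tame_cst.
  by apply/funext => z; rewrite horner0.
rewrite (_ : (fun z => _) = fun z => p.[kernel z] * kernel z ^+ 1 + c).
  exact: tameD (tameM ih (tame_kernelX 1)) (tame_cst c).
by apply/funext => z; rewrite hornerMXaddC expr1.
Qed.

Lemma poly_average_is_linear : scalar poly_average.
Proof.
move=> c p q; rewrite /poly_average.
rewrite -averageZ; last exact: tame_horner.
rewrite -averageD; [|apply: tameM; [exact: tame_cst|exact: tame_horner]|exact: tame_horner].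
by congr average; apply/funext => z; rewrite hornerD hornerZ.
Qed.

HB.instance Definition _ := GRing.isLinear.Build R {poly R} R *%R poly_average
  poly_average_is_linear.

Lemma poly_averageXn n : poly_average 'X^n = moment n.
Proof. by congr average; apply/funext => z; rewrite hornerXn. Qed.

Lemma kernel_bound z : `|kernel z| <= 8.
Proof.
have c3 : `|trig_eval CosAmB z| <= 1 :> R.
  by rewrite /CosAmB /= -cosB ler_norml cos_geN1 cos_le1.
have c1 : `|cos (2 * pi * z.1)| <= 1 :> R by rewrite ler_norml cos_geN1 cos_le1.
have c2 : `|cos (2 * pi * z.2)| <= 1 :> R by rewrite ler_norml cos_geN1 cos_le1.
have -> : kernel z = 2 + 2 * cos (2 * pi * z.1) + 2 * cos (2 * pi * z.2) + 2 * trig_eval CosAmB z.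
  by rewrite /kernel /=; ring.
move: c1 c2 c3; rewrite !ler_norml => /andP[? ?] /andP[? ?] /andP[? ?].
by apply/andP; split; lra.
Qed.
End Franel.

(** * Taylor expansion of the logarithm *)

Local Open Scope complex_scope.

Section ComplexLog.
Context {R : realType}.
Local Notation C := R[i].
Implicit Types (z w : C) (x s : R).
Local Notation normc := (@ComplexField.Normc.normc R).
Local Notation re := (@complex.Re R).

Lemma reD z w : re (z + w) = re z + re w. Proof. by case: z w => [a b] [c d]. Qed.
Lemma reN z : re (- z) = - re z. Proof. by case: z. Qed.
Lemma reZ x z : re (x%:C * z) = x * re z.
Proof. by case: z => [a b]; rewrite /= mul0r subr0. Qed.
Lemma re_sum (I : Type) (r : seq I) (P : pred I) (f : I -> C) :
  re (\sum_(i <- r | P i) f i) = \sum_(i <- r | P i) re (f i).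
Proof. by elim/big_rec2 : _ => // i a b _ <-; rewrite reD. Qed.

Lemma normcX z n : normc (z ^+ n) = normc z ^+ n.
Proof.
elim: n => [|n ih]; first by rewrite !expr0 ComplexField.Normc.normc1.
by rewrite !exprS ComplexField.Normc.normcM ih.
Qed.

Lemma normc_ge0 z : 0 <= normc z.
Proof. by case: z => a b; exact: sqrtr_ge0. Qed.

Lemma normc_gt0 z : (0 < normc z) = (z != 0).
Proof.
rewrite lt_def normc_ge0 andbT; congr negb; apply/eqP/eqP => [|->].
  exact: ComplexField.Normc.eq0_normc.
exact: ComplexField.Normc.normc0.
Qed.

Lemma normcD z w : normc (z + w) <= normc z + normc w.
Proof. exact: le_normcD. Qed.

Lemma normc_opp z : normc (- z) = normc z.
Proof. exact: normcN. Qed.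

Lemma normc_real x : normc x%:C = `|x|.
Proof. by rewrite /= expr0n/= addr0 sqrtr_sqr. Qed.

Lemma normc_sub_ge z w : normc z - normc w <= normc (z - w).
Proof. by rewrite lerBlDr -{1}[z](subrK w) normcD. Qed.

Lemma re_le_normc z : `|re z| <= normc z.
Proof.
case: z => a b /=; rewrite -sqrtr_sqr ler_wsqrtr// lerDl; exact: sqr_ge0.
Qed.

Lemma is_derive_power_sum (c : nat -> R) N x :
  is_derive x (1 : R) (fun s => \sum_(n < N) c n * s ^+ n.+1 / n.+1%:R)
    (\sum_(n < N) c n * x ^+ n).
Proof.
elim: N => [|N ih].
  rewrite big_ord0 (_ : (fun s => _) = cst 0); first exact: is_derive_cst.
  by apply/funext => s; rewrite big_ord0.
rewrite big_ord_recr/= (_ : (fun s => _) = (fun s => \sum_(n < N) c n * s ^+ n.+1 / n.+1%:R) +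
    (fun s => (c N / N.+1%:R) *: (s ^+ N.+1))).
  apply: is_deriveD.
  have h : is_derive x (1 : R) (fun s => (c N / N.+1%:R) *: (s ^+ N.+1)) (c N * x ^+ N).
    have d := is_deriveZ (c N / N.+1%:R) (is_deriveX N.+1 (is_derive_id x (1 : R))).
    rewrite (_ : (fun s => _) = (c N / N.+1%:R) \*: (id ^+ N.+1)).
      apply: (is_derive_eq d); rewrite /GRing.scale/= mulr1.
      by rewrite mulrA divfK// pnatr_eq0.
    by apply/funext => s; rewrite /= exprfctE.
  exact: h.
by apply/funext => s; rewrite big_ord_recr/= fctE /GRing.scale/=; congr (_ + _); ring.
Qed.

Lemma normc_1sub_ge z s : normc z <= 2^-1 -> 0 <= s <= 1 -> 2^-1 <= normc (1 - s%:C * z).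
Proof.
move=> hz /andP[s0 s1]; apply: le_trans (normc_sub_ge _ _).
rewrite ComplexField.Normc.normc1 ComplexField.Normc.normcM normc_real ger0_norm//.
have := normc_ge0 z; nra.
Qed.

Lemma ln_sqrt x : 0 < x -> ln (Num.sqrt x) = ln x / 2.
Proof.
move=> x0; rewrite -{2}(sqr_sqrtr (ltW x0)) lnXn ?sqrtr_gt0// mulr2n.
by field.
Qed.

(** Mean value theorem along the segment from 0 to [z]; the constant 2 bounds [1 / |1 - s z|], since
    [|z| <= 1/2]. *)
Lemma ln_normc_taylor z N : normc z <= 2^-1 ->
  `|ln (normc (1 - z)) + \sum_(n < N) re (z ^+ n.+1) / n.+1%:R| <= 2 * normc z ^+ N.+1.
Proof.
move=> hz.
pose w s := 1 - s%:C * z.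
(* [D s] is [|1 - s z|^2]; using half its logarithm avoids differentiating a square root. *)
pose D s := (1 - s * re z) ^+ 2 + (s * complex.Im z) ^+ 2.
have wD s : normc (w s) = Num.sqrt (D s).
  rewrite /w /D; case: (z) => a b /=; congr Num.sqrt; ring.
pose S s := \sum_(n < N) re (z ^+ n.+1) * s ^+ n.+1 / n.+1%:R.
(* [psi 0 = 0], [psi 1] is the quantity to bound, and [psi' s] is minus the real
   part of the tail [z^(N+1) s^N / (1 - s z)]. *)
pose psi : R -> R := (2^-1 \*: (@ln R \o D)) + S.
have D0 s : 0 <= s <= 1 -> 0 < D s.
  by move=> hs; rewrite -sqrtr_gt0 -wD (lt_le_trans _ (normc_1sub_ge hz hs))// invr_gt0.
pose dD s := - 2 * re z + 2 * (re z ^+ 2 + complex.Im z ^+ 2) * s.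
have dDP s : is_derive s (1 : R) D (dD s).
  (* [D s] is [1 - 2 s Re z + s^2 |z|^2], put in the shape handled by [is_derive_power_sum]. *)
  pose c n : R := if n is 0 then - 2 * re z else 2 * (re z ^+ 2 + complex.Im z ^+ 2).
  have h := is_deriveD (is_derive_cst (1 : R) s (1 : R)) (is_derive_power_sum c 2 s).
  rewrite (_ : D = cst 1 + (fun s => \sum_(n < 2) c n * s ^+ n.+1 / n.+1%:R)).
    by apply: (is_derive_eq h); rewrite add0r !big_ord_recr big_ord0/= /dD; ring.
  by apply/funext => t; rewrite fctE !big_ord_recr big_ord0/= /D; field.
pose dpsi s := dD s / (2 * D s) + \sum_(n < N) re (z ^+ n.+1) * s ^+ n.
have dP s : 0 <= s <= 1 -> is_derive s (1 : R) psi (dpsi s).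
  move=> hs; have hS := is_derive_power_sum (fun n => re (z ^+ n.+1)) N s.
  have h := is_deriveZ (2^-1 : R) (is_derive1_comp (is_derive1_ln (D0 _ hs)) (dDP s)).
  have hh := is_deriveD h hS.
  apply: (is_derive_eq hh); rewrite /dpsi /GRing.scale/=; congr (_ + _).
  by have := lt0r_neq0 (D0 _ hs) => ?; field.
have bound s : 0 <= s <= 1 -> `|dpsi s| <= 2 * normc z ^+ N.+1.
  move=> hs; have w0 : w s != 0.
    by rewrite -normc_gt0 (lt_le_trans _ (normc_1sub_ge hz hs))// invr_gt0.
  have -> : dpsi s = - re (z ^+ N.+1 * s%:C ^+ N / w s).
    have geom : w s * \sum_(n < N) (z ^+ n.+1 * s%:C ^+ n) = z - z ^+ N.+1 * s%:C ^+ N.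
      have -> : \sum_(n < N) (z ^+ n.+1 * s%:C ^+ n) = z * \sum_(n < N) (s%:C * z) ^+ n.
        by rewrite mulr_sumr; apply: eq_bigr => n _; rewrite exprMn exprS; ring.
      rewrite mulrCA -[w s]opprB mulNr -subrX1 exprMn exprS; ring.
    have e1 : \sum_(n < N) re (z ^+ n.+1) * s ^+ n =
        re ((z - z ^+ N.+1 * s%:C ^+ N) / w s).
      rewrite -geom mulrC mulKf// re_sum; apply: eq_bigr => n _.
      by rewrite mulrC -reZ -rmorphXn/= mulrC.
    have e2 : dD s / (2 * D s) = - re (z / w s).
      have D0s := lt0r_neq0 (D0 _ hs).
      (* Write [z / w s = x + i y] and read [(z / w s) * w s = z] in real and imaginary parts. *)
      have := divfK w0 z; move: (z / w s) => [x y]; rewrite /w => /eqP.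
      rewrite /dD; move: D0s; rewrite /D; case: (z) => a b /= D0s.
      rewrite eq_complex/= => /andP[/eqP h1 /eqP h2].
      apply: (mulIf D0s); rewrite mulNr.
      transitivity (- (a * (1 - s * a) - s * b ^+ 2)); first by field.
      have {}h1 : x * (1 - s * a) + y * (s * b) = a.
        by etransitivity; last exact: h1; ring.
      have {}h2 : y * (1 - s * a) - x * (s * b) = b.
        by etransitivity; last exact: h2; ring.
      transitivity (- ((1 - s * a) * (x * (1 - s * a) + y * (s * b))
        - s * b * (y * (1 - s * a) - x * (s * b)))); last by ring.
      by rewrite h1 h2; ring.
    rewrite /dpsi e1 e2 mulrBl reD reN; ring.
  rewrite normrN (le_trans (re_le_normc _))//.
  rewrite !ComplexField.Normc.normcM ComplexField.Normc.normcV !normcX normc_real.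
  move: hs => /andP[s0 s1]; rewrite ger0_norm// mulrC.
  apply: ler_pM => //; first by rewrite invr_ge0 normc_ge0.
  - by rewrite mulr_ge0// exprn_ge0// normc_ge0.
  - by rewrite invf_ple ?posrE ?invr_gt0//; [apply: normc_1sub_ge; rewrite // s0|
      rewrite normc_gt0].
  - by rewrite ler_piMr ?exprn_ge0 ?normc_ge0// exprn_ile1.
have cpsi : {within `[0, 1], continuous psi}.
  apply: derivable_within_continuous => x; rewrite in_itv/= => hx.
  by have [] := dP x hx.
have [|c hc] := MVT_segment (ler01 : 0 <= 1 :> R) _ cpsi (df := dpsi).
  move=> x; rewrite in_itv/= => /andP[x0 x1]; apply: dP; lra.
rewrite subr0 mulr1 => mvt.
have psi0 : psi 0 = 0.
  rewrite /psi fctE /S big1 ?addr0; last by move=> n _; rewrite expr0n/= mulr0 mul0r.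
  by rewrite /= /D !mul0r subr0 expr1n expr0n/= addr0 ln1 scaler0.
have psi1 : psi 1 = ln (normc (1 - z)) + \sum_(n < N) re (z ^+ n.+1) / n.+1%:R.
  rewrite /psi fctE /S; congr (_ + _).
    rewrite -[z in RHS]mul1r -/(w 1) wD ln_sqrt; first by rewrite /GRing.scale/= mulrC.
    by apply: D0; rewrite ler01 lexx.
  by apply: eq_bigr => n _; rewrite expr1n mulr1.
by rewrite -psi1 -[psi 1]subr0 -psi0 mvt bound// -in_itv.
Qed.
End ComplexLog.

(** * The functional equation *)

Section Mahler.
Context {R : realType}.
Local Notation C := R[i].
Implicit Types (t u p r : C) (k : R).
Local Notation normc := (@ComplexField.Normc.normc R).
Local Notation re := (@complex.Re R).

Lemma kernel_expi2pi (z : R * R) (c : C) :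
  let x := expi2pi z.1 in let y := expi2pi z.2 in
  (x + y) * (x + 1) * (y + 1) - c * x * y = x * y * ((kernel z)%:C - c).
Proof.
have ha : sin (2 * pi * z.1) ^+ 2 = 1 - cos (2 * pi * z.1) ^+ 2 by rewrite sin2cos2.
have hb : sin (2 * pi * z.2) ^+ 2 = 1 - cos (2 * pi * z.2) ^+ 2 by rewrite sin2cos2.
rewrite /kernel /expi2pi /=; case: c => c d.
move: ha hb; move: (sin _) (cos _) (sin _) (cos _) => sa ca sb cb ha hb.
apply/eqP; rewrite eq_complex/=; apply/andP; split; apply/eqP; ring: ha hb.
Qed.

Lemma normc_expi2pi (x : R) : normc (expi2pi x) = 1.
Proof. by rewrite /expi2pi /= cos2Dsin2 sqrtr1. Qed.

(** The monomial [x y] has modulus 1 on the torus, so only [|K - p/r| = |p - K r| / |r|] remains.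
    Writing the argument as [r / p] covers both [u^3] and the values of [Yfun]. *)
Lemma g_average r p : r != 0 -> (forall z, p - (kernel z)%:C * r != 0) ->
  tame (fun z => ln (normc (p - (kernel z)%:C * r))) ->
  g (r / p) = (average (fun z => ln (normc (p - (kernel z)%:C * r))) - ln (normc r))%:E.
Proof.
move=> r0 h0 tf; rewrite /g /mahler.
have tc := tame_cst (- ln (normc r)).
rewrite -[X in (_ - X)%:E](opprK) opprK -[- ln (normc r)]average_cst -averageD//.
rewrite -EFin_average; last exact: tameD.
apply: eq_integral => z _; congr EFin.
rewrite invf_div kernel_expi2pi !ComplexField.Normc.normcM !normc_expi2pi !mul1r.
have -> : (kernel z)%:C - p / r = - (p - (kernel z)%:C * r) / r by field.
rewrite mulNr normc_opp ComplexField.Normc.normcM ComplexField.Normc.normcV.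
by rewrite ln_div ?posrE ?normc_gt0.
Qed.

Lemma tame_ln_normc r p M :
  (forall z, `|ln (normc (p - (kernel z)%:C * r))| <= M) ->
  tame (fun z => ln (normc (p - (kernel z)%:C * r))).
Proof.
move=> hM; split; last by exists M => z _.
have mk : measurable_fun square (@kernel R) by have [] := tame_trig (@kernel_trig R).
have -> : (fun z => ln (normc (p - (kernel z)%:C * r))) =
    (@ln R) \o (fun z => (fun x : R => Num.sqrt x) ((re p - kernel z * re r) ^+ 2 +
     (complex.Im p - kernel z * complex.Im r) ^+ 2)).
  by apply/funext => z /=; case: p r {hM} => a b [c d] /=; rewrite !mul0r subr0 addr0.
apply: measurableT_comp; first exact: measurable_ln.
apply: measurableT_comp.
  by apply: continuous_measurable_fun; exact: sqrt_continuous.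
by apply: measurable_funD; apply: measurable_funX; apply: measurable_funB => //;
  apply: measurable_funM.
Qed.

Definition cubicNum t := t - t ^+ 2 + t ^+ 3.
Definition cubicQuad t := 1 + 2 * t + 4 * t ^+ 2.

(** [P] is the cubic in [t] with its coefficients reversed, so its roots are the reciprocal roots;
    it stays monic of degree 3 even at [k = 0], where the cubic drops degree. The factorization is
    given as a series, for power sums, and as a function, for logarithms. *)
Lemma cubic_roots k : `|k| <= 8 -> exists x y z : C,
  [/\ normc x <= 30, normc y <= 30, normc z <= 30,
   cubicDen k%:C = (1 - fpsC x * fpsX) * (1 - fpsC y * fpsX) * (1 - fpsC z * fpsX) &
   forall t, cubicQuad t - k%:C * cubicNum t = (1 - x * t) * (1 - y * t) * (1 - z * t)].
Proof.
move=> hk.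
pose P : {poly C} := 'X^3 + (2 - k%:C)%:P * 'X^2 + (4 + k%:C)%:P * 'X - (k%:C)%:P.
have sP : size P = 4.
  rewrite /P -!addrA size_polyDl size_polyXn//.
  rewrite mul_polyC mul_polyC.
  apply: leq_ltn_trans (size_polyD _ _) _; rewrite gtn_max; apply/andP; split.
    by apply: leq_ltn_trans (size_scale_leq _ _) _; rewrite size_polyXn.
  apply: leq_ltn_trans (size_polyD _ _) _; rewrite gtn_max size_polyN; apply/andP; split.
    by apply: leq_ltn_trans (size_scale_leq _ _) _; rewrite size_polyX.
  by apply: leq_ltn_trans (size_polyC_leq1 _) _.
have lP : lead_coef P = 1.
  by rewrite lead_coefE sP /P !coefD !coefCM coefN !coefXn coefX coefC/=; ring.
have [rs] := closed_field_poly_normal P; rewrite lP scale1r => PE.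
have srs : size rs = 3 by move: sP; rewrite PE size_prod_XsubC => -[].
case: rs srs PE => [|x [|y [|z []]]]// _; rewrite !big_cons big_nil mulr1 => PE.
(* The lower coefficients of [P] are at most 10, 12 and 8 in modulus, which rules out a root beyond
   30. *)
have root w : root P w -> normc w <= 30.
  rewrite /root /P !(hornerD, hornerN, hornerCM, hornerXn, hornerX, hornerC) => /eqP hw; rewrite leNgt; apply/negP => w30.
  have k1 : normc (2 - k%:C) <= 10.
    rewrite (le_trans (normcD _ _))// normc_opp normc_real (_ : 2 = 2%:R%:C); last by rewrite rmorph_nat.
    by rewrite normc_real ger0_norm//; lra.
  have k2 : normc (4 + k%:C) <= 12.
    rewrite (le_trans (normcD _ _))// normc_real (_ : 4 = 4%:R%:C); last by rewrite rmorph_nat.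
    by rewrite normc_real ger0_norm//; lra.
  have e : w ^+ 3 = - ((2 - k%:C) * w ^+ 2) - (4 + k%:C) * w + k%:C.
    by rewrite -[LHS]subr0 -hw; ring.
  have : normc w ^+ 3 <= 10 * normc w ^+ 2 + 12 * normc w + 8.
    rewrite -(normcX w 3) e (le_trans (normcD _ _))// normc_real lerD//.
    rewrite (le_trans (normcD _ _))// !normc_opp (ComplexField.Normc.normcM _ (w ^+ 2)) normcX
      (ComplexField.Normc.normcM _ w).
    by rewrite lerD// ler_wpM2r// ?exprn_ge0 ?normc_ge0.
  by rewrite leNgt => /negP; apply; nra.
exists x, y, z.
have PE' : P = 'X^3 + (- (x + y + z))%:P * 'X^2 + (x * y + y * z + x * z)%:P * 'X
     - (x * y * z)%:P.
  by rewrite PE !(polyCD, polyCM, polyCN); ring.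
have cf i := congr1 (fun p : {poly C} => p`_i) PE'.
have e1 : - (x + y + z) = 2 - k%:C.
  have := cf 2; rewrite /P !(coefD, coefN, coefCM, coefXn, coefX, coefC)/=.
  by rewrite !(mulr0, mulr1, add0r, addr0, subr0) => <-.
have e2 : x * y + y * z + x * z = 4 + k%:C.
  have := cf 1%N; rewrite /P !(coefD, coefN, coefCM, coefXn, coefX, coefC)/=.
  by rewrite !(mulr0, mulr1, add0r, addr0, subr0) => <-.
have e3 : x * y * z = k%:C.
  have := cf 0; rewrite /P !(coefD, coefN, coefCM, coefXn, coefX, coefC)/=.
  by rewrite !(mulr0, mulr1, add0r, addr0, subr0) => /oppr_inj.
split.
- by apply: root; rewrite PE !rootM !root_XsubC eqxx ?orbT.
- by apply: root; rewrite PE !rootM !root_XsubC eqxx ?orbT.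
- by apply: root; rewrite PE !rootM !root_XsubC eqxx ?orbT.
- rewrite /cubicDen.
  have fD : {morph @fpsC C : a b / a + b}.
    by move=> a b; apply: fpsP => -[|n]//; rewrite fpsDE /fpsC addr0.
  have fM : {morph @fpsC C : a b / a * b}.
    by move=> a b; apply: fpsP => n; rewrite fpsCM; case: n => //= n; rewrite mulr0.
  have fN : {morph @fpsC C : a / - a}.
    by move=> a; apply: fpsP => -[|n]//; rewrite fpsNE /fpsC oppr0.
  have f1 : fpsC (1 : C) = 1 by apply: fpsP => -[].
  transitivity (1 + fpsC (- (x + y + z)) * fpsX + fpsC (x * y + y * z + x * z) * fpsX ^+ 2
     - fpsC (x * y * z) * fpsX ^+ 3); last by rewrite !(fD, fN, fM); ring.
  by rewrite e1 e2 e3 !(fD, fN) f1; ring.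
- move=> t; rewrite /cubicQuad /cubicNum.
  transitivity (1 + (2 - k%:C) * t + (4 + k%:C) * t ^+ 2 - k%:C * t ^+ 3); first by ring.
  by rewrite -e1 -e2 -e3; ring.
Qed.
End Mahler.

(** * Ring morphisms applied to coefficients *)

Section FpsMapRing.
Context {S T : comNzRingType} (f : {rmorphism S -> T}).
Implicit Types a b : fps S.

Lemma fps_mapD a b : fps_map f (a + b) = fps_map f a + fps_map f b.
Proof. by apply: fpsP => n; rewrite /fps_map/= rmorphD. Qed.
Lemma fps_mapN a : fps_map f (- a) = - fps_map f a.
Proof. by apply: fpsP => n; rewrite /fps_map/= rmorphN. Qed.
Lemma fps_map1 : fps_map f 1 = 1.
Proof. by apply: fpsP => n; rewrite /fps_map/= rmorph_nat. Qed.
Lemma fps_mapX : fps_map f fpsX = fpsX.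
Proof. by apply: fpsP => n; rewrite /fps_map/= rmorph_nat. Qed.
Lemma fps_mapC x : fps_map f (fpsC x) = fpsC (f x).
Proof. by apply: fpsP => -[|n]; rewrite /fps_map//= rmorph0. Qed.
Lemma fps_map_theta a : fps_map f (theta a) = theta (fps_map f a).
Proof. by apply: fpsP => n; rewrite /fps_map/theta/= rmorphM rmorph_nat. Qed.
Lemma fps_map_exp a n : fps_map f (a ^+ n) = fps_map f a ^+ n.
Proof. by elim: n => [|n ih]; rewrite ?fps_map1// !exprS fps_mapM ih. Qed.
Lemma fps_map_cubicDen x : fps_map f (cubicDen x) = cubicDen (f x).
Proof.
by rewrite /cubicDen !(fps_mapD, fps_mapN, fps_mapM, fps_map_exp, fps_mapC, fps_mapX, fps_map1).
Qed.
End FpsMapRing.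

(** * Averaged expansion of the logarithm of the cubic *)

Section Main.
Context {R : realType}.
Local Notation C := R[i].
Implicit Types (t u : C) (k : R).
Local Notation normc := (@ComplexField.Normc.normc R).
Local Notation re := (@complex.Re R).

(** The power sums [q_n], as polynomials in [k]. *)
Definition powersum_poly (b : fps {poly R}) (n : nat) : {poly R} :=
  (- theta (cubicDen 'X) * b) n.

(** Each of the three linear factors has a Taylor expansion with error [2^-N], and their sum
    involves the roots only through power sums. The radius [1/60] gives [|w t| <= 1/2] for
    [|w| <= 30]. *)
Lemma ln_cubic_taylor (b : fps {poly R}) k t N : cubicDen 'X * b = 1 ->
  `|k| <= 8 -> normc t <= 60^-1 ->
  cubicQuad t - k%:C * cubicNum t != 0 /\
  `|ln (normc (cubicQuad t - k%:C * cubicNum t)) +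
   \sum_(n < N) (powersum_poly b n.+1).[k] * (re (t ^+ n.+1) / n.+1%:R)| <= 3 * 2^-1 ^+ N.
Proof.
move=> hb hk ht.
have [x [y [z [hx hy hz dE pE]]]] := cubic_roots hk.
have small w : normc w <= 30 -> normc (w * t) <= 2^-1.
  move=> hw; rewrite ComplexField.Normc.normcM.
  apply: (le_trans (ler_pM (normc_ge0 _) (normc_ge0 _) hw ht)); lra.
have nz w : normc w <= 30 -> 0 < normc (1 - w * t).
  move=> hw; have h01 : 0 <= (1 : R) <= 1 by rewrite ler01 lexx.
  have := normc_1sub_ge (small w hw) h01; rewrite mul1r => h.
  by rewrite (lt_le_trans _ h)// invr_gt0.
split; first by rewrite pE -normc_gt0 !ComplexField.Normc.normcM !mulr_gt0// nz.
rewrite pE !ComplexField.Normc.normcM !lnM ?posrE ?mulr_gt0 ?nz//.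
(* Evaluation at [k] carries the formal identity over [{poly R}] to the complex numbers, where the
   roots live. *)
pose phi : {rmorphism {poly R} -> C} := real_complex R \o horner_eval k.
have qE n : ((powersum_poly b n.+1).[k])%:C = x ^+ n.+1 + y ^+ n.+1 + z ^+ n.+1.
  have hb' : cubicDen k%:C * fps_map phi b = 1.
    have -> : k%:C = phi 'X by rewrite /= /horner_eval hornerX.
    by rewrite -fps_map_cubicDen -fps_mapM hb fps_map1.
  rewrite -(powersum_of_roots hb' dE).
  have -> : k%:C = phi 'X by rewrite /= /horner_eval hornerX.
  by rewrite -fps_map_cubicDen -fps_map_theta -fps_mapN -fps_mapM.
have T w : normc w <= 30 -> `|ln (normc (1 - w * t)) +
    \sum_(n < N) re ((w * t) ^+ n.+1) / n.+1%:R| <= 2^-1 ^+ N.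
  move=> hw; apply: (le_trans (ln_normc_taylor N (small w hw))).
  have h : normc (w * t) ^+ N.+1 <= 2^-1 ^+ N.+1.
    by apply: lerXn2r; rewrite ?nnegrE ?normc_ge0 ?invr_ge0 ?small.
  have -> : 2^-1 ^+ N = 2 * 2^-1 ^+ N.+1 :> R by rewrite exprS mulrA mulfV ?mul1r.
  by rewrite ler_pM2l.
rewrite (_ : _ + _ = (ln (normc (1 - x * t)) + \sum_(n < N) re ((x * t) ^+ n.+1) / n.+1%:R) +
  (ln (normc (1 - y * t)) + \sum_(n < N) re ((y * t) ^+ n.+1) / n.+1%:R) +
  (ln (normc (1 - z * t)) + \sum_(n < N) re ((z * t) ^+ n.+1) / n.+1%:R)).
  have -> e : 3 * e = e + e + e :> R by ring.
  apply: (le_trans (ler_normD _ _)); apply: lerD (T z hz).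
  by apply: (le_trans (ler_normD _ _)); apply: lerD (T x hx) (T y hy).
have -> : \sum_(n < N) (powersum_poly b n.+1).[k] * (re (t ^+ n.+1) / n.+1%:R) =
   \sum_(n < N) re ((x * t) ^+ n.+1) / n.+1%:R + \sum_(n < N) re ((y * t) ^+ n.+1) / n.+1%:R
   + \sum_(n < N) re ((z * t) ^+ n.+1) / n.+1%:R.
  rewrite -!big_split/=; apply: eq_bigr => n _.
  by rewrite mulrA -reZ qE !exprMn !mulrDl !reD !mulrDl.
ring.
Qed.

(** The finite sum is the value at the kernel of a single polynomial [Q], so the pointwise error
    bound survives averaging. *)
Lemma average_expand (f : R * R -> R) (p : nat -> {poly R}) (c : nat -> R) N B :
  tame f -> (forall z, `|f z + \sum_(n < N) (p n).[kernel z] * c n| <= B) ->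
  `|average f + \sum_(n < N) poly_average (p n) * c n| <= B.
Proof.
move=> tf hB; pose Q := \sum_(n < N) c n *: p n.
have -> : \sum_(n < N) poly_average (p n) * c n = poly_average Q.
  by rewrite linear_sum; apply: eq_bigr => n _; rewrite linearZ/= mulrC.
rewrite /poly_average -averageD//; last exact: tame_horner.
apply: average_norm_le => [|z _]; first by apply: tameD => //; exact: tame_horner.
rewrite /Q horner_sum; apply: le_trans (hB z); rewrite le_eqVlt; apply/orP; left.
apply/eqP; congr (`|_ + _|); apply: eq_bigr => n _.
by rewrite hornerZ mulrC.
Qed.

Lemma geometric_bound_eq0 (x B : R) : (forall N, `|x| <= B * 2^-1 ^+ N) -> x = 0.
Proof.
move=> h; apply/eqP; rewrite -normr_le0 leNgt; apply/negP => x0.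
have B0 : 0 < B by have := h 0%N; rewrite expr0 mulr1; apply: lt_le_trans.
(* Archimedean choice of [N > B / |x|], combined with [N <= 2^N]. *)
pose N := Num.bound (B / `|x|).
have hN : B / `|x| < N%:R.
  have := archi_boundP (_ : 0 <= B / `|x|); apply.
  by rewrite divr_ge0// ltW.
have h2 : N%:R <= 2 ^+ N :> R by rewrite -natrX ler_nat ltnW// ltn_expl.
have := h N; rewrite leNgt => /negP; apply.
rewrite exprVn ltr_pdivrMr ?exprn_gt0// mulrC.
by move: hN; rewrite ltr_pdivrMr// => /lt_le_trans; apply; rewrite ler_pM2r.
Qed.
End Main.

(** * Cube roots of unity and assembly of the identity *)

Section Main.
Context {R : realType}.
Local Notation C := R[i].
Implicit Types (t u s : C).
Local Notation normc := (@ComplexField.Normc.normc R).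
Local Notation re := (@complex.Re R).

Lemma zeta3_sqr : zeta3 ^+ 2 = - 1 - zeta3 :> C.
Proof.
have h : Num.sqrt 3 ^+ 2 = 3 :> R by rewrite sqr_sqrtr.
rewrite /zeta3; move: h; move: (Num.sqrt 3) => q h.
apply/eqP; rewrite expr2 eq_complex/=; apply/andP; split; apply/eqP; last by field.
transitivity (1 / 4 - q ^+ 2 / 4); first by field.
by rewrite h; field.
Qed.

Lemma zeta3_cube : zeta3 ^+ 3 = 1 :> C.
Proof. by have h := zeta3_sqr; rewrite exprS h; ring: h. Qed.

Lemma normc_zeta3X n : normc (zeta3 ^+ n) = 1.
Proof.
have h : normc zeta3 ^+ 3 = 1.
  by rewrite -normcX zeta3_cube ComplexField.Normc.normc1.
rewrite normcX; have /eqP := h; rewrite pexpr_eq1 ?normc_ge0// => /eqP ->.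
by rewrite expr1n.
Qed.

Definition lin_average s : R := average (fun z => ln (normc (1 - (kernel z)%:C * s))).
Definition cubic_average t : R :=
  average (fun z => ln (normc (cubicQuad t - (kernel z)%:C * cubicNum t))).

Lemma normc_kernelM s z : normc s <= 60^-1 -> normc ((kernel z)%:C * s) <= 2^-1.
Proof.
move=> hs; rewrite ComplexField.Normc.normcM normc_real.
apply: (le_trans (ler_pM (normr_ge0 _) (normc_ge0 _) (kernel_bound z) hs)); lra.
Qed.

Lemma normc_taylor_bound s N : normc s <= 2^-1 ->
  `|ln (normc (1 - s)) + \sum_(n < N) re (s ^+ n.+1) / n.+1%:R| <= 2^-1 ^+ N.
Proof.
move=> hs; apply: (le_trans (ln_normc_taylor N hs)).
have h : normc s ^+ N.+1 <= 2^-1 ^+ N.+1.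
  by apply: lerXn2r; rewrite ?nnegrE ?normc_ge0 ?invr_ge0.
have -> : 2^-1 ^+ N = 2 * 2^-1 ^+ N.+1 :> R by rewrite exprS mulrA mulfV ?mul1r.
by rewrite ler_pM2l.
Qed.

Lemma tame_lin s : normc s <= 60^-1 ->
  tame (fun z => ln (normc (1 - (kernel z)%:C * s))).
Proof.
move=> hs; apply: (@tame_ln_normc _ _ _ 1) => z.
(* The expansion with [N = 0] has an empty sum and so bounds the logarithm itself. *)
have := normc_taylor_bound 0 (normc_kernelM z hs).
by rewrite big_ord0 addr0 expr0.
Qed.

Lemma normc_1sub_neq0 s : normc s <= 2^-1 -> 1 - s != 0.
Proof.
move=> hs; have h01 : 0 <= (1 : R) <= 1 by rewrite ler01 lexx.
have := normc_1sub_ge hs h01; rewrite mul1r => h.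
by rewrite -normc_gt0 (lt_le_trans _ h)// invr_gt0.
Qed.

Lemma g_lin s : s != 0 -> normc s <= 60^-1 ->
  g s = (lin_average s - ln (normc s))%:E.
Proof.
move=> s0 hs; rewrite -[in LHS](divr1 s) g_average//; last exact: tame_lin.
by move=> z; apply: normc_1sub_neq0; exact: normc_kernelM.
Qed.

Lemma lin_average_expand s N : normc s <= 60^-1 ->
  `|lin_average s + \sum_(n < N) moment n.+1 * (re (s ^+ n.+1) / n.+1%:R)| <= 2^-1 ^+ N.
Proof.
move=> hs; under eq_bigr do rewrite -poly_averageXn.
apply: (@average_expand _ _ (fun n => 'X^(n.+1)) (fun n => re (s ^+ n.+1) / n.+1%:R)).
  exact: tame_lin.
move=> z; apply: le_trans (normc_taylor_bound N (normc_kernelM z hs)).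
rewrite le_eqVlt; apply/orP; left; apply/eqP; congr (`|_ + _|).
apply: eq_bigr => n _.
by rewrite hornerXn exprMn -rmorphXn/= reZ mulrA.
Qed.

Section Inverse.
Variables (b : fps {poly R}) (hb : cubicDen 'X * b = 1).

Lemma tame_cubic t : normc t <= 60^-1 ->
  tame (fun z => ln (normc (cubicQuad t - (kernel z)%:C * cubicNum t))).
Proof.
move=> ht; apply: (@tame_ln_normc _ _ _ 3) => z.
have [_] := ln_cubic_taylor 0 hb (kernel_bound z) ht.
by rewrite big_ord0 addr0 expr0 mulr1.
Qed.

Lemma cubicNumE t : cubicNum t = t * (1 - (t - t ^+ 2)).
Proof. by rewrite /cubicNum; ring. Qed.

Lemma cubicNum_neq0 t : t != 0 -> normc t <= 60^-1 -> cubicNum t != 0.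
Proof.
move=> t0 ht; rewrite cubicNumE mulf_neq0//; apply: normc_1sub_neq0.
rewrite (le_trans (normcD _ _))// normc_opp normcX.
have := normc_ge0 t; nra.
Qed.

Lemma g_cubic t : t != 0 -> normc t <= 60^-1 ->
  g (Yfun t) = (cubic_average t - ln (normc (cubicNum t)))%:E.
Proof.
move=> t0 ht; have -> : Yfun t = cubicNum t / cubicQuad t.
  by rewrite /Yfun /cubicNum /cubicQuad; congr (_ / _); ring.
rewrite g_average//; [exact: cubicNum_neq0| |exact: tame_cubic].
by move=> z; have [] := ln_cubic_taylor 0 hb (kernel_bound z) ht.
Qed.

Lemma cubic_average_expand t N : normc t <= 60^-1 ->
  `|cubic_average t + \sum_(n < N) poly_average (powersum_poly b n.+1) *
      (re (t ^+ n.+1) / n.+1%:R)| <= 3 * 2^-1 ^+ N.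
Proof.
move=> ht; apply: (@average_expand _ _ (fun n => powersum_poly b n.+1)
  (fun n => re (t ^+ n.+1) / n.+1%:R)); first exact: tame_cubic.
by move=> z; have [] := ln_cubic_taylor N hb (kernel_bound z) ht.
Qed.

(** For [w = zeta3^(n+1)], [1 + w + w^2] is 3 if 3 divides [n+1] and 0 otherwise. Index [3m+2]
    belongs to the exponent [3(m+1)], and [3 / (3(m+1))] leaves the denominator [m+1]. *)
Lemma sum_cube_roots u (c : nat -> R) M :
  \sum_(n < 3 * M) c n * (re ((zeta3 ^+ 0 * u) ^+ n.+1) / n.+1%:R) +
  \sum_(n < 3 * M) c n * (re ((zeta3 ^+ 1 * u) ^+ n.+1) / n.+1%:R) +
  \sum_(n < 3 * M) c n * (re ((zeta3 ^+ 2 * u) ^+ n.+1) / n.+1%:R) =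
  \sum_(m < M) c (3 * m).+2 * (re ((u ^+ 3) ^+ m.+1) / m.+1%:R).
Proof.
rewrite -!big_split/=.
have E n : c n * (re ((zeta3 ^+ 0 * u) ^+ n.+1) / n.+1%:R) +
  c n * (re ((zeta3 ^+ 1 * u) ^+ n.+1) / n.+1%:R) +
  c n * (re ((zeta3 ^+ 2 * u) ^+ n.+1) / n.+1%:R) =
  c n / n.+1%:R * re ((1 + zeta3 ^+ n.+1 + (zeta3 ^+ n.+1) ^+ 2) * u ^+ n.+1).
  rewrite !mulrDl mul1r !reD !exprMn expr0 expr1n mul1r expr1.
  by ring.
under eq_bigr do rewrite E.
have z2 := zeta3_sqr; have z3 := zeta3_cube.
elim: M => [|M ih]; first by rewrite muln0 !big_ord0.
rewrite [RHS]big_ord_recr/= -ih mulnS addnC addn3 !big_ord_recr/= -!addrA; congr (_ + _).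
have zz j : zeta3 ^+ (3 * M + j) = zeta3 ^+ j :> C.
  by rewrite exprD exprM z3 expr1n mul1r.
rewrite -[(3 * M).+3]addn3 -[(3 * M).+2]addn2 -[(3 * M).+1]addn1 !zz z3 expr1.
have -> : 1 + (zeta3 + zeta3 ^+ 2) = 0 :> C by rewrite z2; ring.
have -> : 1 + (zeta3 ^+ 2 + (zeta3 ^+ 2) ^+ 2) = 0 :> C by rewrite z2; ring: z2.
rewrite !mul0r !mulr0 !add0r.
have -> : (1 + (1 + 1 ^+ 2)) * u ^+ (3 * M + 3) = 3%:R%:C * u ^+ (3 * M + 3) :> C.
  by rewrite rmorph_nat; ring.
rewrite reZ -exprM (_ : (3 * M.+1 = 3 * M + 3)%N); last by rewrite mulnS addnC.
rewrite (_ : (3 * M + 3)%:R = 3 * M.+1%:R :> R); last by rewrite -natrM mulnS addnC.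
by field; rewrite nat1r pnatr_eq0.
Qed.

(** The relation [A (q_{3m}) = a_m + 2 (-1)^m] makes the partial sums of both sides equal, so their
    difference is at most a constant times [2^-M] for every [M]. *)
Lemma average_identity u : normc u <= 60^-1 ->
  lin_average (u ^+ 3) + 2 * ln (normc (1 + u ^+ 3)) =
  cubic_average (zeta3 ^+ 0 * u) + cubic_average (zeta3 ^+ 1 * u)
  + cubic_average (zeta3 ^+ 2 * u).
Proof.
move=> hu; apply/eqP; rewrite -subr_eq0; apply/eqP.
have hs : normc (u ^+ 3) <= 60^-1.
  by rewrite normcX; have := normc_ge0 u; nra.
have hz j : normc (zeta3 ^+ j * u) <= 60^-1.
  by rewrite ComplexField.Normc.normcM normc_zeta3X mul1r.
(* The errors add up to 12: 1 for [lin_average], 2 for twice the logarithm, 3 for each of the three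
   cubic averages. *)
apply: (@geometric_bound_eq0 _ _ 12) => M.
have hL := lin_average_expand M hs.
have h1 : `|ln (normc (1 + u ^+ 3)) +
   \sum_(n < M) (-1) ^+ n.+1 * (re ((u ^+ 3) ^+ n.+1) / n.+1%:R)| <= 2^-1 ^+ M.
  have h : normc (- u ^+ 3) <= 2^-1 by rewrite normc_opp; lra.
  have := normc_taylor_bound M h; rewrite opprK.
  rewrite (eq_bigr (fun n : 'I_M => (-1) ^+ n.+1 * (re ((u ^+ 3) ^+ n.+1) / n.+1%:R)))//.
  move=> n _; rewrite [in LHS]exprNn mulrA -reZ.
  by rewrite rmorphXn rmorphN1.
(* Truncation at [3 * M] gives whole blocks of three; the error is relaxed to the common scale
   [2^-M]. *)
have hc j : `|cubic_average (zeta3 ^+ j * u) + \sum_(n < 3 * M)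
    poly_average (powersum_poly b n.+1) * (re ((zeta3 ^+ j * u) ^+ n.+1) / n.+1%:R)|
    <= 3 * 2^-1 ^+ M.
  apply: (le_trans (cubic_average_expand (3 * M) (hz j))).
  rewrite ler_pM2l// ler_wiXn2l ?invr_ge0//; last by rewrite leq_pmull.
  by rewrite invf_le1// ler1n.
have := sum_cube_roots u (fun n => poly_average (powersum_poly b n.+1)) M.
rewrite (eq_bigr (fun m : 'I_M => moment m.+1 * (re ((u ^+ 3) ^+ m.+1) / m.+1%:R)
   + 2 * ((-1) ^+ m.+1 * (re ((u ^+ 3) ^+ m.+1) / m.+1%:R)))); last first.
  move=> m _; rewrite (_ : (3 * m).+3 = (3 * m.+1)%N); last by rewrite mulnS.
  rewrite /powersum_poly (@scalar_cubicDen_powersum _ poly_average moment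
    (@poly_averageXn R) (@moment0 R) (@moment_franel R) _ hb).
  by ring.
rewrite big_split/= -mulr_sumr.
have := hc 0%N; have := hc 1%N; have := hc 2%N; move: hL h1.
set a0 := lin_average _; set a1 := ln _; set c0 := cubic_average _.
set c1 := cubic_average _; set c2 := cubic_average _.
set S0 := \sum_(n < M) _; set S1 := \sum_(n < M) _.
set T0 := \sum_(n < 3 * M) _; set T1 := \sum_(n < 3 * M) _; set T2 := \sum_(n < 3 * M) _.
move: (2^-1 ^+ M) => e.
rewrite !ler_norml => /andP[? ?] /andP[? ?] /andP[? ?] /andP[? ?] /andP[? ?] ?.
by apply/andP; split; lra.
Qed.

(** Since [N(t) = t (1 + t^3) / (1 + t)] and the three factors [1 + zeta3^j u] multiply to
    [1 + u^3], the numerators multiply to [u^3 (1 + u^3)^2]. *)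
Lemma normc_cubicNum_prod u : u != 0 -> normc u <= 60^-1 ->
  ln (normc (cubicNum (zeta3 ^+ 0 * u))) + ln (normc (cubicNum (zeta3 ^+ 1 * u)))
  + ln (normc (cubicNum (zeta3 ^+ 2 * u))) =
  ln (normc (u ^+ 3)) + 2 * ln (normc (1 + u ^+ 3)).
Proof.
move=> u0 hu.
have pos j : 0 < normc (cubicNum (zeta3 ^+ j * u)).
  rewrite normc_gt0 cubicNum_neq0 ?ComplexField.Normc.normcM ?normc_zeta3X ?mul1r//.
  by rewrite mulf_neq0// -normc_gt0 normc_zeta3X.
have p1 : 0 < normc (1 + u ^+ 3).
  rewrite normc_gt0 -[u ^+ 3]opprK normc_1sub_neq0// normc_opp normcX.
  by have := normc_ge0 u; nra.
have p3 : 0 < normc (u ^+ 3) by rewrite normc_gt0 expf_neq0.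
rewrite -!lnM ?posrE ?mulr_gt0// mulr_natl -lnXn// -lnM ?posrE ?exprn_gt0//.
congr ln; rewrite -normcX -!ComplexField.Normc.normcM; congr normc.
have h := zeta3_sqr; rewrite /cubicNum expr0 expr1 mul1r h.
by ring: h.
Qed.
End Inverse.

End Main.

Theorem mainTheorem8 (R : realType) :
  exists delta : R, 0 < delta /\
    forall u : R[i], 0 < ComplexField.Normc.normc u < delta ->
      g (u ^+ 3) = (\sum_(j < 3) g (Yfun (zeta3 ^+ j * u)%R))%E.
Proof.
(* Within this radius the reciprocal roots, at most 30 in modulus, satisfy the Taylor estimates. *)
exists 60^-1; split; first by rewrite invr_gt0.
move=> u /andP[]; rewrite normc_gt0 => u0 /ltW hu.
have [b hb] := fps_inv_exists (cubicDen0 ('X : {poly R})).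
have hs : ComplexField.Normc.normc (u ^+ 3) <= 60^-1.
  by rewrite normcX; have := normc_ge0 u; nra.
have gj j : g (Yfun (zeta3 ^+ j * u)) = (cubic_average (zeta3 ^+ j * u)
    - ln (ComplexField.Normc.normc (cubicNum (zeta3 ^+ j * u))))%:E.
  apply: (g_cubic hb); last by rewrite ComplexField.Normc.normcM normc_zeta3X mul1r.
  by rewrite mulf_neq0// -normc_gt0 normc_zeta3X.
have sum3 (F : nat -> \bar R) : (\sum_(j < 3) F j = F 0%N + (F 1%N + F 2%N))%E.
  by rewrite !big_ord_recl big_ord0 adde0.
rewrite (sum3 (fun j => g (Yfun (zeta3 ^+ j * u)%R))).
rewrite (gj 0%N) (gj 1%N) (gj 2%N) g_lin ?expf_neq0// -!EFinD; congr EFin.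
(* The two identities share the term [2 ln |1 + u^3|], which cancels. *)
have := normc_cubicNum_prod u0 hu; have := average_identity hb hu.
move: (lin_average _) (ln _) (cubic_average _) (cubic_average _) (cubic_average _).
move=> a l c0 c1 c2; move: (ln _) (ln _) (ln _) (ln _) => l0 l1 l2 l3; lra.
Qed.
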